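(* Let $G$ be a finite subgroup of the orthogonal group $O(n)$ such that each linear operator on $\mathbb{R}^n$ commuting with all elements of $G$ is a scalar multiple of the identity. Then for every $y\in S(l_2^n)$ the Minkowski sum of segments $$A=\frac{n}{|G|}\sum_{g\in G}[-g(y),g(y)]$$ is a small sufficient enlargement for $l_2^n$.
   Context: All spaces are real; $l_2^n$ is $\mathbb{R}^n$ with the Euclidean norm. $B(X)$ and $S(X)$ denote the (closed) unit ball and the unit sphere of a normed space $X$. A ball in a finite dimensional linear space means a bounded closed convex set with nonempty interior that is symmetric with respect to $0$. A ball $A$ in a finite dimensional normed space $X$ is called a sufficient enlargement for $X$ if for every Banach space $Y$ and every isometric linear embedding of $X$ into $Y$ (identify $X$ with its image) there exists a continuous linear projection $P:Y\to X$ onto $X$ such that $P(B(Y))\subset A$. The absolute projection constant $\lambda(X)$ of a finite dimensional normed space $X$ is the smallest positive real number such that for every isometric embedding of $X$ into a Banach space $Y$ there exists a continuous linear projection $P:Y\to X$ onto $X$ with $\|P\|\le\lambda(X)$. A sufficient enlargement $A$ for $l_2^n$ is called small if $$\int_{O(n)}T(A)\,d\mu(T)=\lambda(l_2^n)\,B(l_2^n),$$ where $\mu$ is the normalized Haar measure on $O(n)$. Here the integral of convex bodies is understood in the Minkowski sense: it is the compact convex set whose support function is $x\mapsto\int_{O(n)}h(T(A),x)\,d\mu(T)$, where $h(K,x)=\sup_{k\in K}\langle k,x\rangle$. *)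

(* Defs.v *)
From HB Require Import structures.
From mathcomp Require Import all_boot all_order all_algebra finmap.
From mathcomp Require Import all_classical all_reals all_analysis ring.

Set Implicit Arguments.
Unset Strict Implicit.
Unset Printing Implicit Defensive.

Import Order.TTheory GRing.Theory Num.Theory.
Import numFieldNormedType.Exports.

Local Open Scope classical_set_scope.
Local Open Scope ring_scope.

(* The alias hides the sup norm that the library puts on matrices, so that
   l2 R n can carry the Euclidean norm and the topology generated by it. *)
Definition l2 (R : realType) (n : nat) : Type := 'cV[R]_n.

HB.instance Definition _ (R : realType) (n : nat) :=
  GRing.Lmodule.on (l2 R n).

Section EuclideanNorm.
Variables (R : realType) (n : nat).
Implicit Types x y : l2 R n.

Definition l2_entry x (i : 'I_n) : R := (x : 'cV[R]_n) i ord0.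

Definition l2_dot x y : R := \sum_(i < n) l2_entry x i * l2_entry y i.

Definition l2_norm x : R := Num.sqrt (l2_dot x x).

Lemma l2_dotC x y : l2_dot x y = l2_dot y x.
Proof. by apply: eq_bigr => i _; rewrite mulrC. Qed.

Lemma l2_dotDl x x' y : l2_dot (x + x') y = l2_dot x y + l2_dot x' y.
Proof.
by rewrite -big_split; apply: eq_bigr => i _; rewrite /l2_entry !mxE mulrDl.
Qed.

Lemma l2_dotZl (a : R) x y : l2_dot (a *: x) y = a * l2_dot x y.
Proof.
by rewrite mulr_sumr; apply: eq_bigr => i _; rewrite /l2_entry !mxE mulrA.
Qed.

Lemma l2_dotDr x y y' : l2_dot x (y + y') = l2_dot x y + l2_dot x y'.
Proof. by rewrite l2_dotC l2_dotDl !(l2_dotC _ x). Qed.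

Lemma l2_dotZr (a : R) x y : l2_dot x (a *: y) = a * l2_dot x y.
Proof. by rewrite l2_dotC l2_dotZl l2_dotC. Qed.

Lemma l2_dot_ge0 x : 0 <= l2_dot x x.
Proof. by apply: sumr_ge0 => i _; rewrite -expr2 sqr_ge0. Qed.

Lemma l2_norm_sq x : l2_norm x ^+ 2 = l2_dot x x.
Proof. by rewrite sqr_sqrtr// l2_dot_ge0. Qed.

Lemma l2_dot_eq0 x : l2_dot x x = 0 -> x = 0.
Proof.
move=> /eqP; rewrite psumr_eq0 => [/allP h|i _]; last by rewrite -expr2 sqr_ge0.
apply/matrixP => i j; rewrite ord1 mxE.
by have := h i (mem_index_enum i); rewrite mulf_eq0 orbb => /eqP.
Qed.

Lemma l2_norm0_eq0 x : l2_norm x = 0 -> x = 0.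
Proof. by move=> h; apply: l2_dot_eq0; rewrite -l2_norm_sq h expr0n. Qed.

Lemma l2_normZ (a : R) x : l2_norm (a *: x) = `|a| * l2_norm x.
Proof.
by rewrite /l2_norm l2_dotZl l2_dotZr mulrA -expr2 sqrtrM ?sqr_ge0// sqrtr_sqr.
Qed.

Lemma l2_cauchy_schwarz x y : l2_dot x y <= l2_norm x * l2_norm y.
Proof.
have [y0|yN0] := eqVneq (l2_norm y) 0.
  rewrite y0 mulr0 (l2_norm0_eq0 y0) -[X in l2_dot x X](scale0r x).
  by rewrite l2_dotZr mul0r.
have [x0|xN0] := eqVneq (l2_norm x) 0.
  rewrite x0 mul0r (l2_norm0_eq0 x0) -[X in l2_dot X y](scale0r y).
  by rewrite l2_dotZl mul0r.
have xy0 : 0 < l2_norm x * l2_norm y.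
  by rewrite mulr_gt0// lt_def ?xN0 ?yN0 sqrtr_ge0.
have := l2_dot_ge0 (l2_norm y *: x + (- l2_norm x) *: y).
rewrite !(l2_dotDl, l2_dotDr, l2_dotZl, l2_dotZr) -!l2_norm_sq (l2_dotC y x).
set a := l2_norm x in xy0 *; set b := l2_norm y in xy0 *; set d := l2_dot x y.
rewrite (_ : _ + _ = a * b * (2 * (a * b - d))); last by ring.
by rewrite pmulr_rge0// pmulr_rge0// subr_ge0.
Qed.

Lemma ler_l2_normD x y : l2_norm (x + y) <= l2_norm x + l2_norm y.
Proof.
rewrite -ler_sqr ?nnegrE ?addr_ge0 ?sqrtr_ge0//.
rewrite l2_norm_sq l2_dotDl !l2_dotDr (l2_dotC y x) sqrrD -!l2_norm_sq.
rewrite -subr_ge0 (_ : _ - _ = (l2_norm x * l2_norm y - l2_dot x y) *+ 2).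
  by rewrite mulrn_wge0// subr_ge0 l2_cauchy_schwarz.
by ring.
Qed.

End EuclideanNorm.

HB.instance Definition _ (R : realType) (n : nat) :=
  @Lmodule_isNormed.Build R (l2 R n) (@l2_norm R n) (@ler_l2_normD R n)
    (@l2_normZ R n) (@l2_norm0_eq0 R n).

Section SufficientEnlargements.
Variable R : realType.

Definition unit_ball (X : normedModType R) : set X := [set x | `|x| <= 1].
Arguments unit_ball X : clear implicits.

Definition convex_body_ball (X : normedModType R) (A : set X) : Prop :=
  [/\ bounded_set A, closed A, convex_set A, A° !=set0 &
      forall x, A x -> A (- x)].

Definition isometric_embedding (X Y : normedModType R) (i : {linear X -> Y})
  : Prop := forall x, `|i x| = `|x|.

(* X is identified with its image under i, so that a projection of Y onto X
   becomes a linear map P : Y -> X with P \o i = id. *)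
Definition continuous_projection (X Y : normedModType R) (i : {linear X -> Y})
    (P : {linear Y -> X}) : Prop :=
  continuous P /\ forall x, P (i x) = x.

Definition operator_norm (X Y : normedModType R) (f : X -> Y) : R :=
  sup [set `|f x| | x in unit_ball X].

(* The notions below are only meant for finite dimensional X. *)
Definition sufficient_enlargement (X : normedModType R) (A : set X) : Prop :=
  convex_body_ball A /\
  forall (Y : completeNormedModType R) (i : {linear X -> Y}),
    isometric_embedding i ->
    exists P : {linear Y -> X},
      continuous_projection i P /\ P @` unit_ball Y `<=` A.

Definition projection_bound (X : normedModType R) (c : R) : Prop :=
  forall (Y : completeNormedModType R) (i : {linear X -> Y}),
    isometric_embedding i ->
    exists P : {linear Y -> X},
      continuous_projection i P /\ operator_norm P <= c.

(* The least positive projection bound; 0 is a dummy value, returned only when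
   no least one exists. *)
Definition absolute_projection_constant (X : normedModType R) : R :=
  xget 0 [set c | [/\ 0 < c, projection_bound X c &
                      forall c', 0 < c' -> projection_bound X c' -> c <= c']].

Definition minkowski_add (X : lmodType R) (A B : set X) : set X :=
  [set a + b | a in A & b in B].

Definition scale_set (X : lmodType R) (c : R) (A : set X) : set X :=
  [set c *: a | a in A].

Definition segment (X : lmodType R) (a b : X) : set X :=
  [set (1 - t) *: a + t *: b | t in `[0, 1]].

End SufficientEnlargements.
Arguments unit_ball {R} X.

Section OrthogonalGroup.
Variables (R : realType) (n : nat).

Definition orthogonal_group : set 'M[R]_n := [set T | T *m T^T = 1%:M].

Definition mx_act (T : 'M[R]_n) (x : l2 R n) : l2 R n := T *m (x : 'cV[R]_n).

Definition finite_orthogonal_subgroup (G : {fset 'M[R]_n}) : Prop :=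
  [/\ forall g, g \in G -> orthogonal_group g,
      1%:M \in G,
      forall g h, g \in G -> h \in G -> g *m h \in G &
      forall g, g \in G -> invmx g \in G].

Definition borel_mx := g_sigma_algebraType (@open 'M[R]_n).

(* Haar measure on O(n), viewed as a Borel probability measure on the space of
   all matrices that is concentrated on O(n). *)
Definition normalized_haar (mu : probability borel_mx R) : Prop :=
  mu (orthogonal_group : set borel_mx) = 1%E /\
  forall (T : 'M[R]_n) (E : set borel_mx), orthogonal_group T -> measurable E ->
    mu ((fun S : 'M[R]_n => T *m S) @` E : set borel_mx) = mu E.

Definition support_function (K : set (l2 R n)) (x : l2 R n) : R :=
  sup [set l2_dot k x | k in K].

Definition is_minkowski_integral (mu : probability borel_mx R)
    (F : 'M[R]_n -> set (l2 R n)) (K : set (l2 R n)) : Prop :=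
  [/\ K !=set0, compact K, convex_set K &
      forall x, ((support_function K x)%:E =
        \int[mu]_(T in (orthogonal_group : set borel_mx))
          (support_function (F T) x)%:E)%E].

(* mu ranges over all measures satisfying the characterization of the
   normalized Haar measure, which is unique. *)
Definition small_sufficient_enlargement (A : set (l2 R n)) : Prop :=
  sufficient_enlargement A /\
  forall mu : probability borel_mx R, normalized_haar mu ->
    is_minkowski_integral mu (fun T => mx_act T @` A)
      (scale_set (absolute_projection_constant (l2 R n)) (unit_ball (l2 R n))).

End OrthogonalGroup.

(* Main.v *)
Require Import Defs.
From HB Require Import structures.
From mathcomp Require Import all_boot all_order all_algebra finmap.
From mathcomp Require Import all_classical all_reals all_analysis.
From mathcomp Require Import measurable_realfun ring lra.
Import Order.TTheory GRing.Theory Num.Theory.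
Import numFieldNormedType.Exports.
Local Open Scope classical_set_scope.
Local Open Scope ring_scope.

Set Implicit Arguments.
Unset Strict Implicit.
Unset Printing Implicit Defensive.

(* By Schur's argument the orbit of y is a tight frame:
   x = (n/|G|) sum_g <gy, x> gy. Extending each functional <gy, .>, of norm one,
   by Hahn-Banach to the space Y turns this identity into a projection that maps
   B(Y) into A.

   The support function of T(A) at x is (n/|G|) sum_g |<x, T gy>|. By invariance
   its Haar mean is |x| times the average over g of n m(gy), where m(z) is the
   mean of |<z, T z>|. So it is enough that lambda(l_2^n) = n m(z) for every
   unit vector z.

   Upper bound: the trace of an operator V on R^n is n times the mean of
   <V(Tz), Tz>, hence at most n times the mean of |V(Tz)|. The latter expression
   is a seminorm on the operators from R^n to Y, and a Hahn-Banach extension of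
   the trace that it dominates is represented by a projection of norm at most
   n m(z).

   Lower bound: embed R^n into the bounded functions on R^n by
   x |-> (t |-> <x, t/|t|>), and let P be a projection of norm c. For a
   polynomial p with |p| <= 1 on [-1, 1] that approximates the sign, let f_T be
   the function t |-> p(<t/|t|, Tz>) of norm at most one. By invariance the mean
   of <P f_T, Tz> is n times the mean of <z, Tz> p(<z, Tz>), which is close to
   n m(z); it is also at most c. *)

(** * The Hahn-Banach theorem *)

Section HahnBanach.
Variables (R : realType) (V : lmodType R).
Implicit Types p q : V -> R.

(** The inequality for scalars amounts to equality: for [a > 0] apply it again with [a^-1], and for
    [a = 0] subadditivity gives [0 <= p 0]. *)
Definition sublinear p :=
  (forall x y, p (x + y) <= p x + p y) /\
  (forall (a : R) x, 0 <= a -> p (a *: x) <= a * p x).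

Lemma sublinear_ge p x y : sublinear p -> p x - p (- y) <= p (x + y).
Proof.
by move=> [pD _]; rewrite lerBlDr -[X in p X <= _](addrK y) pD.
Qed.

(* A pair [(c, b)] of the cone [C] encodes the constraint that a functional
   dominated by [q] is at most [b] at [- c]. *)
Lemma sublinear_inf p (C : set (V * R)) : sublinear p ->
  C (0, 0) ->
  (forall c d, C c -> C d -> C (c.1 + d.1, c.2 + d.2)) ->
  (forall (a : R) c, 0 <= a -> C c -> C (a *: c.1, a * c.2)) ->
  (forall c, C c -> 0 <= p c.1 + c.2) ->
  exists q, sublinear q /\ forall x c, C c -> q x <= p (x + c.1) + c.2.
Proof.
move=> pl C0 CD CZ Cp; have [pD pZ] := pl.
pose S x := [set p (x + c.1) + c.2 | c in C].
have Slb x : has_inf (S x).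
  split; first by exists (p (x + 0) + 0); exists (0, 0).
  (* Subadditivity gives [p (x + c.1) >= p c.1 - p (- x)], and [p c.1 + c.2] is nonnegative on the
     cone. *)
  exists (- p (- x)) => _ [c Cc <-]; rewrite addrC.
  have := sublinear_ge c.1 x pl; have := Cp c Cc; rewrite (addrC c.1).
  by lra.
have qle x c : C c -> inf (S x) <= p (x + c.1) + c.2.
  by move=> Cc; apply: ge_inf; [exact: (Slb x).2|exists c].
exists (fun x => inf (S x)); split => //; split => [x y|a x a0].
- rewrite -lerBlDr; apply: lb_le_inf; first exact: (Slb x).1.
  move=> _ [c Cc <-]; rewrite lerBlDr -lerBlDl.
  apply: lb_le_inf; first exact: (Slb y).1.
  move=> _ [d Cd <-]; have /= := qle (x + y) _ (CD _ _ Cc Cd).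
  have := pD (x + c.1) (y + d.1); rewrite addrACA.
  by lra.
- have [->|aN0] := eqVneq a 0.
    rewrite scale0r mul0r (le_trans (qle 0 _ C0))//= !addr0.
    by have := pZ 0 0 (lexx _); rewrite scale0r mul0r.
  have {}a0 : 0 < a by rewrite lt_def aN0.
  rewrite -ler_pdivrMl//; apply: lb_le_inf; first exact: (Slb x).1.
  move=> _ [c Cc <-]; rewrite ler_pdivrMl//.
  apply: le_trans (qle _ _ (CZ _ _ (ltW a0) Cc)) _ => /=.
  by rewrite -scalerDr mulrDr lerD2r pZ// ltW.
Qed.

(** The pointwise infimum is such a [q]. It is finite since [r x >= - r (- x) >= - p (- x)], and
    subadditive since of two members of a chain the smaller one serves both summands. *)
Lemma sublinear_chain_inf p (A : set (V -> R)) : A !=set0 ->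
  (forall q, A q -> sublinear q /\ forall x, q x <= p x) ->
  total_on A (fun q r => forall x, r x <= q x) ->
  exists q, [/\ sublinear q, forall x, q x <= p x &
                forall r, A r -> forall x, q x <= r x].
Proof.
move=> [q0 Aq0] Ap Atot; pose S x := [set r x | r in A].
have Sinf x : has_inf (S x).
  split; first by exists (q0 x); exists q0.
  exists (- p (- x)) => _ [r Ar <-]; have [rl rp] := Ap r Ar.
  have := sublinear_ge 0 x rl; rewrite add0r.
  have := rl.2 0 0 (lexx _); rewrite scale0r mul0r.
  have := rl.1 0 0; rewrite addr0.
  by have := rp (- x); lra.
have qle x r : A r -> inf (S x) <= r x.
  by move=> Ar; apply: ge_inf; [exact: (Sinf x).2|exists r].
exists (fun x => inf (S x)); split; first split.
- move=> x y; rewrite -lerBlDr; apply: lb_le_inf; first exact: (Sinf x).1.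
  move=> _ [r Ar <-]; rewrite lerBlDr -lerBlDl.
  apply: lb_le_inf; first exact: (Sinf y).1.
  move=> _ [s As <-]; rewrite lerBlDl.
  have [sr|rs] := Atot _ _ Ar As.
    apply: le_trans (qle _ _ As) _; apply: le_trans ((Ap s As).1.1 _ _) _.
    by rewrite lerD2r.
  apply: le_trans (qle _ _ Ar) _; apply: le_trans ((Ap r Ar).1.1 _ _) _.
  by rewrite lerD2l.
- move=> a x; rewrite le_eqVlt => /predU1P[<-|a0].
    by rewrite (le_trans (qle _ _ Aq0))// mul0r scale0r;
      have := (Ap q0 Aq0).1.2 0 0 (lexx _); rewrite scale0r mul0r.
  rewrite -ler_pdivrMl//; apply: lb_le_inf; first exact: (Sinf x).1.
  move=> _ [r Ar <-]; rewrite ler_pdivrMl//.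
  exact: le_trans (qle _ _ Ar) ((Ap r Ar).1.2 _ _ (ltW a0)).
- by move=> x; apply: le_trans (qle _ _ Aq0) ((Ap q0 Aq0).2 x).
- by move=> r Ar x; exact: qle.
Qed.

Lemma sublinear_minimal p : sublinear p ->
  exists q, [/\ sublinear q, forall x, q x <= p x &
    forall r, sublinear r -> (forall x, r x <= q x) -> forall x, r x = q x].
Proof.
move=> pl; pose T := {q : V -> R | sublinear q /\ forall x, q x <= p x}.
(* The order is reversed, so that the maximal element of Zorn's lemma is a minimal functional. *)
pose le (q r : T) := `[< forall x, sval r x <= sval q x >].
have pT : sublinear p /\ forall x, p x <= p x by [].
have [|q r s /asboolP qr /asboolP rs|A Atot|[q [ql qp]] qmin] :=
    @ZL_preorder T (exist _ p pT) le.
- by move=> q; apply/asboolP => x.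
- by apply/asboolP => x; exact: le_trans (rs x) (qr x).
- have [A0|A0] := pselect (A !=set0); last first.
    by exists (exist _ p pT) => s As; case: A0; exists s.
  have [| | |q [ql qp qA]] := @sublinear_chain_inf p [set sval r | r in A].
  + by have [r Ar] := A0; exists (sval r); exists r.
  + by move=> _ [[r [rl rp]] Ar <-].
  + move=> _ _ [r Ar <-] [s As <-].
    by have [/asboolP|/asboolP] := Atot _ _ Ar As; [left|right].
  exists (exist _ q (conj ql qp)) => s As; apply/asboolP => x.
  by apply: qA; exists s.
- exists q; split=> // r rl rq x.
  have rT : sublinear r /\ forall x, r x <= p x.
    by split=> // z; exact: le_trans (rq z) (qp z).
  apply/le_anti; rewrite rq/=.
  by have /asboolP/(_ x) := qmin (exist _ r rT) (asboolT rq).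
Qed.

(** For a fixed [x], minimality identifies [q] with a sublinear [r] such that
    [r z <= q (z + t x) - t q x] for all [t >= 0]. Taking [z = - x] and [t = 1] gives
    [q (- x) <= - q x]; so [q] is odd, and an odd subadditive function is additive. *)
Lemma minimal_sublinear_linear q : sublinear q ->
  (forall r, sublinear r -> (forall x, r x <= q x) -> forall x, r x = q x) ->
  linear (q : V -> R^o).
Proof.
move=> ql qmin; have [qD qZ] := ql.
have q0 : q 0 = 0.
  apply/le_anti; have := qZ 0 0 (lexx _); rewrite scale0r mul0r => ->/=.
  by have := qD 0 0; rewrite addr0; lra.
have qZp (a : R) x : 0 <= a -> q (a *: x) = a * q x.
  rewrite le_eqVlt => /predU1P[<-|a0]; first by rewrite scale0r mul0r.
  apply/le_anti; rewrite qZ ?(ltW a0)//=.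
  have := qZ a^-1 (a *: x); rewrite invr_ge0 ltW// => /(_ isT).
  by rewrite scalerA mulVf ?gt_eqF// scale1r ler_pdivlMl.
have qN x : q (- x) = - q x.
  have [| | | |r [rl rC]] := @sublinear_inf q
      [set c | exists2 t : R, 0 <= t & c = (t *: x, - (t * q x))] ql.
  - by exists 0 => //; rewrite scale0r mul0r oppr0.
  - move=> _ _ [t t0 ->] [s s0 ->]; exists (t + s); first exact: addr_ge0.
    by rewrite /= scalerDl mulrDl opprD.
  - move=> a _ a0 [t t0 ->]; exists (a * t); first exact: mulr_ge0.
    by rewrite /= scalerA mulrN mulrA.
  - by move=> _ [t t0 ->] /=; rewrite qZp// subrr.
  have rq z : r z <= q z.
    have := rC z (0, 0); rewrite /= !addr0; apply.
    by exists 0 => //; rewrite scale0r mul0r oppr0.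
  apply/le_anti; apply/andP; split; last first.
    by have := qD x (- x); rewrite subrr q0; lra.
  rewrite -(qmin r rl rq).
  have := rC (- x) (x, - q x); rewrite /= addNr q0 add0r; apply.
  by exists 1 => //; rewrite scale1r mul1r.
have qA x y : q (x + y) = q x + q y.
  apply/le_anti; rewrite qD/=.
  by have := qD (- x) (- y); rewrite -opprD !qN; lra.
move=> a x y; rewrite qA; congr (_ + _).
have [a0|a0] := leP 0 a; first exact: qZp.
have := qZp (- a) x; rewrite oppr_ge0 ltW// => /(_ isT).
by rewrite scaleNr qN => /eqP; rewrite mulNr eqr_opp => /eqP.
Qed.

(** The cone of [sublinear_inf] is chosen to impose [F (j w) <= f w] for all [w]; replacing [w] by
    [- w] turns this into equality. Linearity of [F] comes from minimality. *)
Lemma hahn_banach (W : lmodType R) (j : {linear W -> V}) (f : {scalar W}) p :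
  sublinear p -> (forall w, f w <= p (j w)) ->
  exists F : {scalar V}, (forall w, F (j w) = f w) /\ forall x, F x <= p x.
Proof.
move=> pl fp.
have [| | | |q [ql qC]] := @sublinear_inf p [set (j (- w), f w) | w in setT] pl.
- by exists 0 => //; rewrite oppr0 !linear0.
- by move=> _ _ [v _ <-] [w _ <-]; exists (v + w) => //;
    rewrite opprD !linearD.
- by move=> a _ a0 [w _ <-]; exists (a *: w) => //; rewrite -scalerN !linearZ.
- by move=> _ [w _ <-] /=; have := fp (- w); rewrite linearN; lra.
have [F [Fl Fq Fmin]] := sublinear_minimal ql.
have Flin := minimal_sublinear_linear Fl Fmin.
pose FL := GRing.isLinear.Build R V R^o _ F Flin.
pose F' : {scalar V} := HB.pack F FL.
have FC x w : F' x <= p (x + j (- w)) + f w.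
  by apply: le_trans (Fq x) (qC x (j (- w), f w) _); exists w.
exists F'; split => [w|x]; last first.
  by have := FC x 0; rewrite oppr0 !linear0 !addr0.
have p0 : p 0 <= 0 by have := pl.2 0 0 (lexx _); rewrite scale0r mul0r.
have Fle v : F' (j v) <= f v.
  by apply: le_trans (FC _ v) _; rewrite linearN subrr gerDr.
apply/le_anti; rewrite Fle/=.
by have := Fle (- w); rewrite !linearN lerN2.
Qed.

End HahnBanach.

(** * The Banach space of bounded functions *)

Section BoundedFunctions.
Variables (R : realType) (T : pointedType).

Definition bounded_functions : {pred T -> R} :=
  fun f => `[< exists M, forall t, `|f t| <= M >].

Lemma bounded_functionsP (f : T -> R) :
  reflect (exists M, forall t, `|f t| <= M) (f \in bounded_functions).
Proof. exact: asboolP. Qed.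

Lemma bounded_functions_submod_closed : submod_closed bounded_functions.
Proof.
split; first by apply/bounded_functionsP; exists 0 => t; rewrite normr0.
move=> a f g /bounded_functionsP[M fM] /bounded_functionsP[N gN].
apply/bounded_functionsP; exists (`|a| * M + N) => t.
by rewrite (le_trans (ler_normD _ _))// lerD// normrM ler_wpM2l.
Qed.

HB.instance Definition _ := GRing.isSubmodClosed.Build R (T -> R)
  bounded_functions bounded_functions_submod_closed.

Record bounded_function := BoundedFunction {
  bounded_function_val :> T -> R;
  _ : bounded_function_val \in bounded_functions }.

HB.instance Definition _ := [isSub of bounded_function for
  bounded_function_val].
HB.instance Definition _ := [Choice of bounded_function by <:].
HB.instance Definition _ := [SubChoice_isSubLmodule of bounded_function by <:].

Implicit Types f g : bounded_function.

Definition sup_norm f : R := sup (range (fun t => `|f t|)).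

Lemma has_sup_range_norm f : has_sup (range (fun t => `|f t|)).
Proof.
split; first by exists `|f point|; exists point.
have /bounded_functionsP[M fM] := valP f.
by exists M => _ [t _ <-]; exact: fM.
Qed.

Lemma le_sup_norm f t : `|f t| <= sup_norm f.
Proof. by apply: ub_le_sup; [exact: (has_sup_range_norm f).2|exists t]. Qed.

Lemma sup_norm_le f M : (forall t, `|f t| <= M) -> sup_norm f <= M.
Proof.
move=> fM; apply: ge_sup; first exact: (has_sup_range_norm f).1.
by move=> _ [t _ <-]; exact: fM.
Qed.

Lemma ler_sup_normD f g : sup_norm (f + g) <= sup_norm f + sup_norm g.
Proof.
by apply: sup_norm_le => t; rewrite (le_trans (ler_normD _ _))// lerD//
  le_sup_norm.
Qed.

Lemma sup_normZ (a : R) f : sup_norm (a *: f) = `|a| * sup_norm f.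
Proof.
have leZ b h : sup_norm (b *: h) <= `|b| * sup_norm h.
  by apply: sup_norm_le => t; rewrite normrM ler_wpM2l// le_sup_norm.
apply/le_anti; rewrite leZ/=; have [->|a0] := eqVneq a 0.
  by rewrite normr0 mul0r (le_trans _ (le_sup_norm _ point)).
have := leZ a^-1 (a *: f).
by rewrite scalerA mulVf// scale1r normfV ler_pdivlMl ?normr_gt0.
Qed.

Lemma sup_norm_eq0 f : sup_norm f = 0 -> f = 0.
Proof.
move=> f0; apply/val_inj/funext => t; apply/eqP.
by rewrite -normr_le0 -f0 le_sup_norm.
Qed.

HB.instance Definition _ :=
  @Lmodule_isNormed.Build R bounded_function sup_norm ler_sup_normD sup_normZ
    sup_norm_eq0.

(** The limit is the pointwise limit [l]. To bound [|f t - l t|] uniformly in [t], pass through some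
    [g] that is close to [f] in norm and, depending on [t], close to [l] at [t]. *)
Lemma bounded_function_complete (F : set_system bounded_function) :
  ProperFilter F -> cauchy F -> cvg F.
Proof.
move=> FF /cauchy_ballP Fc.
have dist_le (t : T) f g (e : R) : `|f - g| < e -> `|f t - g t| < e.
  exact/le_lt_trans/(le_sup_norm (f - g) t).
have Ft t : cvg ((fun f : bounded_function => f t) @ F).
  apply: R_complete; apply/cauchy_ballP => e e0; rewrite near_map2.
  have := Fc e e0; apply: filterS => -[f g] /=.
  by rewrite -!ball_normE; exact: dist_le.
pose l t := lim ((fun f : bounded_function => f t) @ F).
have lF (e : R) : 0 < e ->
    \forall f \near F, forall t, `|bounded_function_val f t - l t| <= e.
  move=> e0; near=> f => t; rewrite -(addr0 e); apply/ler_addgt0Pr => d d0.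
  near F => g; rewrite -(subrKA (g t)) addr0 (le_trans (ler_normD _ _))//
    lerD//.
    apply/ltW/dist_le; near: g; near: f.
    apply: nearP_dep; have := Fc e e0; apply: filterS => -[f g] /=.
    by rewrite -ball_normE.
  rewrite distrC; near: g.
  by move/cvgrPdist_le: (Ft t) => /(_ d d0).
have lb : l \in bounded_functions.
  near F => f; apply/bounded_functionsP; exists (`|f| + 1) => t.
  have fl : forall t, `|f t - l t| <= 1 by near: f; exact: lF.
  rewrite -[l t](subKr (f t)) (le_trans (ler_normB _ _))// lerD//.
  exact: le_sup_norm.
apply/cvg_ex; exists (BoundedFunction lb); apply/cvgrPdist_le => e e0.
near=> f; apply: sup_norm_le => t; rewrite distrC; move: t.
by near: f; exact: lF.
Unshelve. all: by end_near. Qed.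

HB.instance Definition _ :=
  Uniform_isComplete.Build bounded_function bounded_function_complete.

End BoundedFunctions.

(** * Averages over the orthogonal group *)

Section Euclidean.
Variables (R : realType) (n : nat).
Implicit Types (x y z w : l2 R n) (S T : 'M[R]_n).

Lemma l2_dot_mxE x y : l2_dot x y = ((x : 'cV_n)^T *m (y : 'cV_n)) 0 0.
Proof. by rewrite mxE; apply: eq_bigr => i _; rewrite mxE. Qed.

Lemma l2_dotNr x y : l2_dot x (- y) = - l2_dot x y.
Proof. by rewrite -scaleN1r l2_dotZr mulN1r. Qed.

Lemma l2_dotNl x y : l2_dot (- x) y = - l2_dot x y.
Proof. by rewrite l2_dotC l2_dotNr l2_dotC. Qed.

Lemma l2_dot0r x : l2_dot x 0 = 0.
Proof. by rewrite -(scale0r x) l2_dotZr mul0r. Qed.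

Lemma l2_dot0l x : l2_dot 0 x = 0.
Proof. by rewrite l2_dotC l2_dot0r. Qed.

Lemma l2_dot_sumr x I (r : seq I) (P : pred I) (F : I -> l2 R n) :
  l2_dot x (\sum_(i <- r | P i) F i) = \sum_(i <- r | P i) l2_dot x (F i).
Proof.
elim/big_rec2: _ => [|i a b _ <-]; first exact: l2_dot0r.
by rewrite l2_dotDr.
Qed.

Lemma l2_dot_suml x I (r : seq I) (P : pred I) (F : I -> l2 R n) :
  l2_dot (\sum_(i <- r | P i) F i) x = \sum_(i <- r | P i) l2_dot (F i) x.
Proof.
by rewrite l2_dotC l2_dot_sumr; apply: eq_bigr => i _; rewrite l2_dotC.
Qed.

Lemma normr_sq_l2 x : `|x| ^+ 2 = l2_dot x x.
Proof. exact: l2_norm_sq. Qed.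

Lemma ler_norm_l2_dot x y : `|l2_dot x y| <= `|x| * `|y|.
Proof.
rewrite ler_norml l2_cauchy_schwarz andbT lerNl -l2_dotNr.
by rewrite (le_trans (l2_cauchy_schwarz _ _))//= -[l2_norm (- y)]/(`|- y|)
  normrN.
Qed.

Lemma l2_dot_injr x y : (forall z, l2_dot z x = l2_dot z y) -> x = y.
Proof.
move=> xy; apply/eqP; rewrite -subr_eq0; apply/eqP/l2_dot_eq0.
by rewrite l2_dotDr l2_dotNr xy subrr.
Qed.

Definition l2_basis (i : 'I_n) : l2 R n := delta_mx i 0.

Lemma l2_entry_basis i j : l2_entry (l2_basis i) j = (j == i)%:R.
Proof. by rewrite /l2_entry mxE andbT. Qed.

Lemma l2_dot_basisr x i : l2_dot x (l2_basis i) = l2_entry x i.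
Proof.
rewrite /l2_dot (bigD1 i)//= big1 ?addr0; last first.
  by move=> j ji; rewrite {2}/l2_entry mxE (negPf ji) mulr0.
by rewrite {2}/l2_entry mxE !eqxx mulr1.
Qed.

Lemma norm_l2_basis i : `|l2_basis i| = 1.
Proof.
apply/eqP; rewrite -(@eqrXn2 _ 2) ?ler01// expr1n normr_sq_l2.
by rewrite l2_dot_basisr l2_entry_basis eqxx.
Qed.

Lemma l2_entryD x y i : l2_entry (x + y) i = l2_entry x i + l2_entry y i.
Proof. by rewrite -!l2_dot_basisr l2_dotDl. Qed.

Lemma l2_entryZ (a : R) x i : l2_entry (a *: x) i = a * l2_entry x i.
Proof. by rewrite -!l2_dot_basisr l2_dotZl. Qed.

Lemma mx_actZ T (a : R) x : mx_act T (a *: x) = a *: mx_act T x.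
Proof. by rewrite /mx_act -scalemxAr. Qed.

Lemma mx_actM S T x : mx_act (S *m T) x = mx_act S (mx_act T x).
Proof. by rewrite /mx_act mulmxA. Qed.

Lemma mx_act1 x : mx_act 1%:M x = x.
Proof. exact: mul1mx. Qed.

Lemma l2_dot_mx_act T x y : l2_dot (mx_act T x) y = l2_dot x (mx_act T^T y).
Proof. by rewrite !l2_dot_mxE /mx_act trmx_mul mulmxA. Qed.

Lemma orthogonal_trmx T : orthogonal_group T -> orthogonal_group T^T.
Proof. by move=> OT; apply: mulmx1C; rewrite trmxK. Qed.

Lemma orthogonal_mul S T : orthogonal_group S -> orthogonal_group T ->
  orthogonal_group (S *m T).
Proof.
rewrite /orthogonal_group /= => OS OT.
by rewrite trmx_mul mulmxA -(mulmxA S) OT mulmx1 OS.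
Qed.

Lemma orthogonal_dot T x y : orthogonal_group T ->
  l2_dot (mx_act T x) (mx_act T y) = l2_dot x y.
Proof.
move=> /orthogonal_trmx; rewrite /orthogonal_group/= trmxK => OT.
by rewrite l2_dot_mx_act -mx_actM OT mx_act1.
Qed.

Lemma orthogonal_norm T x : orthogonal_group T -> `|mx_act T x| = `|x|.
Proof. by move=> OT; congr Num.sqrt; exact: orthogonal_dot. Qed.

(** The Householder reflection in the hyperplane orthogonal to [w]. *)
Definition reflection w : 'M[R]_n :=
  1%:M - (2 / l2_dot w w) *: ((w : 'cV_n) *m (w : 'cV_n)^T).

Lemma reflectionE w x :
  mx_act (reflection w) x = x - (2 * l2_dot w x / l2_dot w w) *: w.
Proof.
rewrite /mx_act /reflection mulmxBl mul1mx -scalemxAl -mulmxA.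
congr (_ - _); rewrite [_^T *m _]mx11_scalar -l2_dot_mxE mul_mx_scalar.
by rewrite scalerA mulrAC.
Qed.

Lemma reflection_sym w : (reflection w)^T = reflection w.
Proof.
by rewrite /reflection linearB/= linearZ/= trmx1 trmx_mul trmxK.
Qed.

(* For [w = 0] division by zero makes [reflection w] the identity. *)
Lemma reflection_orthogonal w : orthogonal_group (reflection w).
Proof.
rewrite /orthogonal_group/= reflection_sym.
suff inv x : mx_act (reflection w *m reflection w) x = x.
  by apply/matrixP => i j; have := inv (l2_basis j);
    rewrite /mx_act -colE => /(congr1 (fun v : 'cV[R]_n => v i 0));
      rewrite !mxE eqxx andbT.
have [w0|w0] := eqVneq (l2_dot w w) 0.
  by rewrite mx_actM !reflectionE w0 invr0 !mulr0 !scale0r !subr0.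
rewrite mx_actM !reflectionE l2_dotDr l2_dotNr l2_dotZr.
rewrite -addrA -opprD -scalerDl [X in X *: w](_ : _ = 0) ?scale0r ?subr0//.
by field.
Qed.

(** The reflection along [x - z] takes [x] to [z], because equal norms give
    [2 <x - z, x> = |x - z|^2]. *)
Lemma orthogonal_transitive x z : `|x| = `|z| ->
  exists2 S, orthogonal_group S & mx_act S x = z.
Proof.
move=> /(congr1 (fun r => r ^+ 2)); rewrite !normr_sq_l2 => xz.
exists (reflection (x - z)); first exact: reflection_orthogonal.
rewrite reflectionE; have [w0|w0] := eqVneq (l2_dot (x - z) (x - z)) 0.
  by rewrite (l2_dot_eq0 w0) scaler0 subr0; apply/eqP;
    rewrite -subr_eq0 (l2_dot_eq0 w0).
rewrite (_ : 2 * _ = l2_dot (x - z) (x - z)) ?divff ?scale1r ?subKr//.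
rewrite !(l2_dotDl, l2_dotDr, l2_dotNl, l2_dotNr) (l2_dotC z x) -xz.
by ring.
Qed.

End Euclidean.

(** * Measurability on the space of matrices and functions bounded on O(n) *)

Section OrthogonalMean.
Variables (R : realType) (n : nat) (mu : probability (borel_mx R n) R).
Implicit Types (x y z w : l2 R n) (S T : 'M[R]_n) (f g : 'M[R]_n -> R).

(** Expansion in matrix units makes [L] a finite sum of coordinates with constant coefficients in
    [Y]. *)
Lemma linear_mx_continuous (Y : normedModType R) (L : {linear 'M[R]_n -> Y}) :
  continuous L.
Proof.
have -> : L = (fun T => \sum_i \sum_j T i j *: L (delta_mx i j)) :> (_ -> _).
  apply/funext => T; rewrite {1}(matrix_sum_delta T) linear_sum.
  by apply: eq_bigr => i _; rewrite linear_sum; apply: eq_bigr => j _;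
    rewrite linearZ.
apply: continuous_big => [|i _]; first exact: add_continuous.
apply: continuous_big => [|j _ T]; first exact: add_continuous.
by apply: (@cvgZr_tmp _ _ _ (nbhs T)); exact: coord_continuous.
Qed.

Lemma continuous_measurable_borel_mx f : continuous f ->
  measurable_fun setT (f : borel_mx R n -> R).
Proof.
move=> fc; apply: (measurability (@RGenOInfty.G R)).
  exact: RGenOInfty.measurableE.
move=> _ [_ [a ->] <-]; rewrite setTI; apply: sub_sigma_algebra.
by apply: open_comp => // T _; exact: fc.
Qed.

Lemma mulmx_measurable S :
  measurable_fun setT ((fun T => S *m T) : borel_mx R n -> borel_mx R n).
Proof.
apply: (@measurability _ _ (borel_mx R n) (borel_mx R n) _ _ (@open 'M[R]_n))
  => // _ [A oA <-].
rewrite setTI; apply: sub_sigma_algebra; apply: open_comp => // T _.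
exact: (@linear_mx_continuous _ (@mulmx _ n n n S)).
Qed.

(** The group is the zero set of [dist], a polynomial in the entries. *)
Lemma orthogonal_group_measurable :
  measurable (@orthogonal_group R n : set (borel_mx R n)).
Proof.
pose dist (T : 'M[R]_n) := \sum_i \sum_j ((T *m T^T - 1%:M) i j) ^+ 2.
have -> : @orthogonal_group R n = dist @^-1` [set 0].
  apply/seteqP; split => T; rewrite /orthogonal_group/= /dist.
    by move=> ->; rewrite big1// => i _; rewrite big1// => j _;
      rewrite subrr mxE expr0n.
  move=> /eqP; rewrite psumr_eq0 => [/allP d0|i _]; last first.
    by apply: sumr_ge0 => j _; rewrite sqr_ge0.
  apply/eqP; rewrite -subr_eq0; apply/eqP/matrixP => i j; rewrite [RHS]mxE.
  have := d0 i (mem_index_enum _); rewrite implyTb psumr_eq0 => [/allP|k _].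
    by move=> /(_ j (mem_index_enum _)); rewrite sqrf_eq0 => /eqP.
  by rewrite sqr_ge0.
rewrite -[X in measurable X]setTI.
suff : measurable_fun setT (dist : borel_mx R n -> R) by apply.
apply: measurable_sum => i; apply: measurable_sum => j.
apply: measurable_funX.
under eq_fun => T.
  rewrite mxE mxE; under eq_bigr do rewrite [T^T _ _]mxE.
  over.
apply: measurable_funD; last exact: measurable_cst.
apply: measurable_sum => k.
by apply: measurable_funM; apply: continuous_measurable_borel_mx;
  exact: coord_continuous.
Qed.

Definition mean f : R :=
  \int[mu]_(T in (@orthogonal_group R n : set (borel_mx R n))) f T.

(** Boundedness is asked on O(n) only, which carries the measure: linear functions of [T] are in
    general unbounded on the space of all matrices. *)
Definition tame f := measurable_fun setT (f : borel_mx R n -> R) /\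
  exists M, forall T, orthogonal_group T -> `|f T| <= M.

Lemma tame_cst (a : R) : tame (fun=> a).
Proof. by split; [exact: measurable_cst|exists `|a|]. Qed.

Lemma tameD f g : tame f -> tame g -> tame (fun T => f T + g T).
Proof.
move=> [mf [M fM]] [mg [N gN]]; split; first exact: measurable_funD.
by exists (M + N) => T OT; rewrite (le_trans (ler_normD _ _))// lerD ?fM ?gN.
Qed.

Lemma tameM f g : tame f -> tame g -> tame (fun T => f T * g T).
Proof.
move=> [mf [M fM]] [mg [N gN]]; split; first exact: measurable_funM.
by exists (M * N) => T OT; rewrite normrM ler_pM ?fM ?gN.
Qed.

Lemma tame_sum I (r : seq I) (F : I -> 'M[R]_n -> R) :
  (forall i, tame (F i)) -> tame (fun T => \sum_(i <- r) F i T).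
Proof.
move=> tF; elim: r => [|i r IH].
  by under eq_fun do rewrite big_nil; exact: tame_cst.
by under eq_fun do rewrite big_cons; exact: tameD.
Qed.

Lemma tame_norm f : tame f -> tame (fun T => `|f T|).
Proof.
move=> [mf [M fM]]; split; first exact: measurableT_comp.
by exists M => T OT; rewrite normr_id fM.
Qed.

End OrthogonalMean.

(** * Invariance of the Haar mean and the moments of [<x, T y>] *)

Section HaarMean.
Variables (R : realType) (n : nat) (mu : probability (borel_mx R n) R).
Hypothesis haar : normalized_haar mu.
Implicit Types (x y z w : l2 R n) (S T : 'M[R]_n) (f g : 'M[R]_n -> R).

Let orth_measurable := @orthogonal_group_measurable R n.

Lemma tameX f k : tame f -> tame (fun T => f T ^+ k).
Proof.
move=> tf; elim: k => [|k IH]; first exact: tame_cst.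
by under eq_fun do rewrite exprS; exact: tameM.
Qed.

Lemma tame_horner (p : {poly R}) f : tame f -> tame (fun T => p.[f T]).
Proof.
move=> tf; under eq_fun do rewrite horner_coef.
by apply: tame_sum => k; apply: tameM; [exact: tame_cst|exact: tameX].
Qed.

Lemma orthogonal_entry_le1 T (i j : 'I_n) : orthogonal_group T -> `|T i j| <= 1.
Proof.
move=> OT.
have -> : T i j = l2_dot (mx_act T (l2_basis R j)) (l2_basis R i).
  by rewrite l2_dot_basisr /l2_entry /mx_act -colE mxE.
by rewrite (le_trans (ler_norm_l2_dot _ _))// orthogonal_norm//
  !norm_l2_basis mulr1.
Qed.

(** Serves for [T |-> V (T y)] with an operator [V] from R^n into an arbitrary normed space. *)
Lemma tame_norm_linear (Y : normedModType R) (L : 'M[R]_n -> Y) : linear L ->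
  tame (fun T => `|L T|).
Proof.
move=> Ll; pose LL := GRing.isLinear.Build R _ _ _ L Ll.
pose L' : {linear 'M[R]_n -> Y} := HB.pack L LL.
split.
  apply: continuous_measurable_borel_mx => // T.
  apply: continuous_comp; last exact: norm_continuous.
  exact: (@linear_mx_continuous _ _ _ L').
exists (\sum_i \sum_j `|L (delta_mx i j)|) => T OT.
rewrite normr_id -[L]/(L' : _ -> _) {1}(matrix_sum_delta T) linear_sum.
rewrite (le_trans (ler_norm_sum _ _ _))// ler_sum// => i _.
rewrite linear_sum (le_trans (ler_norm_sum _ _ _))// ler_sum// => j _.
by rewrite linearZ/= normrZ ler_piMl// orthogonal_entry_le1.
Qed.

Lemma tame_dot x y : tame (fun T => l2_dot x (mx_act T y)).
Proof.
apply: tame_sum => i; apply: tameM; first exact: tame_cst.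
rewrite /l2_entry /mx_act; under eq_fun do rewrite mxE.
apply: tame_sum => j; apply: tameM; last exact: tame_cst.
split; last by exists 1 => T; exact: orthogonal_entry_le1.
by apply: continuous_measurable_borel_mx => //; exact: coord_continuous.
Qed.

Lemma tame_integrable f : tame f ->
  mu.-integrable (@orthogonal_group R n : set (borel_mx R n)) (EFin \o f).
Proof.
move=> [mf [M fM]]; apply: measurable_bounded_integrable => //.
- by have := ltry (1 : R); rewrite -haar.1.
- exact: measurable_funTS.
- exists M; split; first exact: num_real.
  by move=> N MN T OT; exact: le_trans (fM T OT) (ltW MN).
Qed.

Lemma mean_cst (a : R) : mean mu (fun=> a) = a.
Proof.
rewrite /mean Rintegral_cst// -[RHS]mulr1; congr (_ * _).
exact: (congr1 fine haar.1).
Qed.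

Lemma eq_mean f g : (forall T, orthogonal_group T -> f T = g T) ->
  mean mu f = mean mu g.
Proof. by move=> fg; apply: eq_Rintegral => T /set_mem; exact: fg. Qed.

Lemma meanD f g : tame f -> tame g ->
  mean mu (fun T => f T + g T) = mean mu f + mean mu g.
Proof. by move=> tf tg; apply: RintegralD => //; exact: tame_integrable. Qed.

Lemma meanZ (a : R) f : tame f ->
  mean mu (fun T => a * f T) = a * mean mu f.
Proof. by move=> tf; apply: RintegralZl => //; exact: tame_integrable. Qed.

Lemma mean_sum I (r : seq I) (F : I -> 'M[R]_n -> R) :
  (forall i, tame (F i)) ->
  mean mu (fun T => \sum_(i <- r) F i T) = \sum_(i <- r) mean mu (F i).
Proof.
move=> tF; elim: r => [|i r IH].
  by under eq_fun do rewrite big_nil; rewrite big_nil mean_cst.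
rewrite big_cons -IH -meanD//; first by under eq_fun do rewrite big_cons.
exact: tame_sum.
Qed.

Lemma le_mean f g : tame f -> tame g ->
  (forall T, orthogonal_group T -> f T <= g T) -> mean mu f <= mean mu g.
Proof. by move=> tf tg fg; apply: le_Rintegral => //;
  exact: tame_integrable. Qed.

Lemma tame_mulmx S f : orthogonal_group S -> tame f ->
  tame (fun T => f (S *m T)).
Proof.
move=> OS [mf [M fM]]; split.
  exact: (measurableT_comp mf (mulmx_measurable S)).
by exists M => T OT; apply/fM/orthogonal_mul.
Qed.

(** Change of variables uses preimages under [T |-> S T], while invariance is stated for images; the
    preimage under [S] is the image under [S^T]. *)
Lemma mean_mulmx S f : orthogonal_group S -> tame f ->
  mean mu (fun T => f (S *m T)) = mean mu f.
Proof.
move=> OS tf; have OS' := orthogonal_trmx OS.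
pose phi : borel_mx R n -> borel_mx R n := fun T => S *m T.
have mphi : measurable_fun setT phi by exact: mulmx_measurable.
have phiO : phi @^-1` (@orthogonal_group R n : set (borel_mx R n)) =
    (@orthogonal_group R n : set (borel_mx R n)).
  apply/seteqP; split => T /=; last exact: orthogonal_mul.
  move=> /(orthogonal_mul OS').
  by rewrite /phi mulmxA; move: OS'; rewrite {1}/orthogonal_group/= trmxK =>
    ->; rewrite mul1mx.
have phiE (E : set (borel_mx R n)) :
    phi @^-1` E = (fun T : 'M[R]_n => S^T *m T) @` E.
  apply/seteqP; split => T.
    move=> ET; exists (phi T) => //; rewrite /phi mulmxA.
    by move: OS'; rewrite {1}/orthogonal_group/= trmxK => ->; rewrite mul1mx.
  by move=> [U EU <-]; rewrite /phi/= mulmxA OS mul1mx.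
rewrite /mean /Rintegral; congr fine.
rewrite -{1}phiO -(integral_pushforward mphi (f := EFin \o f))//.
- apply: eq_measure_integral => A mA _.
  apply: etrans (haar.2 _ _ OS' mA); exact: (congr1 mu (phiE A)).
- by move: tf.1 => mf; apply: measurableT_comp mf.
- by rewrite phiO; exact: (tame_integrable (tame_mulmx OS tf)).
Qed.

(** Some orthogonal [S] takes [x] to [|x| y], and [<x, T y> = <S x, S T y>]; invariance then
    replaces [S T] by [T]. *)
Lemma mean_dot_aligned (h : R -> R) x y : `|y| = 1 ->
  tame (fun T => h (l2_dot (`|x| *: y) (mx_act T y))) ->
  mean mu (fun T => h (l2_dot x (mx_act T y))) =
  mean mu (fun T => h (`|x| * l2_dot y (mx_act T y))).
Proof.
move=> y1 th.
have [|S OS Sx] := @orthogonal_transitive _ _ x (`|x| *: y).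
  by rewrite normrZ normr_id y1 mulr1.
under [in RHS]eq_fun do rewrite -l2_dotZl.
rewrite -(mean_mulmx OS th); apply: eq_mean => T OT.
by rewrite mx_actM -Sx orthogonal_dot.
Qed.

(** For a unit vector [y], half the mean width of the segment from [- y] to [y]. *)
Definition mean_width y : R := mean mu (fun T => `|l2_dot y (mx_act T y)|).

Lemma mean_norm_dot x y : `|y| = 1 ->
  mean mu (fun T => `|l2_dot x (mx_act T y)|) = mean_width y * `|x|.
Proof.
move=> y1; rewrite (@mean_dot_aligned Num.norm)//; last first.
  exact/tame_norm/tame_dot.
under eq_fun do rewrite normrM normr_id.
by rewrite meanZ 1?mulrC//; exact/tame_norm/tame_dot.
Qed.

(** The quadratic form [q u u] is a multiple of [|u|^2] by rotation invariance, and polarization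
    extends this to [q u v]. Summing over a basis, with [|T y| = 1], shows that the factor is
    [1 / n]. *)
Lemma mean_dot_dot x z y : `|y| = 1 ->
  n%:R * mean mu (fun T => l2_dot x (mx_act T y) * l2_dot z (mx_act T y)) =
  l2_dot x z.
Proof.
move=> y1.
have tdd u v : tame (fun T => l2_dot u (mx_act T y) * l2_dot v (mx_act T y)).
  by apply: tameM; exact: tame_dot.
pose q u v := mean mu (fun T => l2_dot u (mx_act T y) * l2_dot v (mx_act T y)).
have qxx u : q u u = q y y * l2_dot u u.
  rewrite /q (@mean_dot_aligned (fun r => r * r) u y y1 (tdd _ _)).
  under eq_fun do rewrite mulrACA.
  by rewrite meanZ// mulrC -expr2 normr_sq_l2.
have qD u v : q (u + v) (u + v) = q u u + 2 * q u v + q v v.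
  rewrite /q -meanZ// -!meanD//; last first.
  - by apply: tameM; [exact: tame_cst|exact: tdd].
  - by apply: tameD => //; apply: tameM; [exact: tame_cst|exact: tdd].
  by apply: eq_mean => T _; rewrite l2_dotDl; ring.
have quv u v : q u v = q y y * l2_dot u v.
  have := qD u v; rewrite (qxx (u + v)) (qxx u) (qxx v) !(l2_dotDl, l2_dotDr).
  by rewrite (l2_dotC v u); move: (q u v) (q y y) => a b; lra.
have nq : n%:R * q y y = 1.
  rewrite -[RHS]mean_cst; transitivity (\sum_(i < n) q (l2_basis R i) (l2_basis
    R i)).
    rewrite mulr_natl -[X in _ *+ X]card_ord -sumr_const; apply: eq_bigr => i _.
    by rewrite [RHS]qxx l2_dot_basisr /l2_entry mxE !eqxx mulr1.
  rewrite /q -mean_sum//; apply: eq_mean => T OT.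
  under eq_bigr do rewrite !(l2_dotC (l2_basis R _)) !l2_dot_basisr.
  by rewrite -[LHS]/(l2_dot _ _) orthogonal_dot// -normr_sq_l2 y1 expr1n.
by rewrite -/(q x z) quv mulrA nq mul1r.
Qed.

(** On [-1, 1] one has [s^2 <= |s|], and [n] times the mean of [<y, T y>^2] is one. *)
Lemma mean_width_gt0 y : `|y| = 1 -> 0 < n%:R * mean_width y.
Proof.
move=> y1; apply: (@lt_le_trans _ _ 1) => //.
rewrite -[leLHS](expr1n _ 2) -{1}y1 normr_sq_l2 -(mean_dot_dot y y y1).
rewrite ler_wpM2l// le_mean//.
- by apply: tameM; exact: tame_dot.
- by apply: tame_norm; exact: tame_dot.
- move=> T OT; rewrite -expr2 -real_normK ?num_real// expr2 ler_piMr//.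
  by rewrite (le_trans (ler_norm_l2_dot _ _))// orthogonal_norm// y1 mulr1.
Qed.

(** The left side is linear in [w]. It vanishes for [w] orthogonal to [z], since the reflection
    along [w] fixes [z] and changes the sign of [w]. So it is a multiple of [<w, z>], and a rotation
    of [y] to [z] computes the factor. *)
Lemma mean_horner_dot (p : {poly R}) y z w : `|y| = 1 -> `|z| = 1 ->
  mean mu (fun T => l2_dot w (mx_act T y) * p.[l2_dot z (mx_act T y)]) =
  mean mu (fun T => l2_dot y (mx_act T y) * p.[l2_dot y (mx_act T y)]) *
  l2_dot w z.
Proof.
move=> y1 z1; pose H u v := mean mu
  (fun T => l2_dot u (mx_act T y) * p.[l2_dot v (mx_act T y)]).
have tH u v : tame (fun T => l2_dot u (mx_act T y) * p.[l2_dot v (mx_act T y)]).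
  by apply: tameM; [exact: tame_dot|apply: tame_horner; exact: tame_dot].
have HS S u v : orthogonal_group S -> H (mx_act S u) (mx_act S v) = H u v.
  move=> OS; rewrite /H -(mean_mulmx OS (tH _ _)).
  by apply: eq_mean => T OT; rewrite mx_actM !orthogonal_dot.
have HD u u' v : H (u + u') v = H u v + H u' v.
  by rewrite /H -meanD//; apply: eq_mean => T OT; rewrite l2_dotDl mulrDl.
have HZ a u v : H (a *: u) v = a * H u v.
  by rewrite /H -meanZ//; apply: eq_mean => T OT; rewrite l2_dotZl mulrA.
have Hperp u : l2_dot u z = 0 -> H u z = 0.
  move=> uz; have [u0|u0] := eqVneq (l2_dot u u) 0.
    by have := HZ 0 u z; rewrite mul0r scale0r (l2_dot_eq0 u0).
  have := HS (reflection u) u z (reflection_orthogonal u).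
  rewrite !reflectionE uz mulr0 mul0r scale0r subr0 mulfK//.
  by rewrite -[X in X - _]scale1r -scaleNr -scalerDl HZ; lra.
have zz : l2_dot z z = 1 by rewrite -normr_sq_l2 z1 expr1n.
rewrite -/(H w z) -/(H y y) -[in LHS](subrK (l2_dot w z *: z) w) HD Hperp;
  last first.
  by rewrite l2_dotDl l2_dotNl l2_dotZl zz mulr1 subrr.
rewrite add0r HZ mulrC; congr (_ * _).
have [|S OS <-] := @orthogonal_transitive _ _ y z; first by rewrite y1.
exact: HS.
Qed.

End HaarMean.

(** * The absolute projection constant of Euclidean space *)

Section ProjectionConstant.
Variables (R : realType) (n : nat).

Lemma bounded_linear_continuous_le (X Y : normedModType R) (f : {linear X -> Y})
    (M : R) : (forall x, `|f x| <= M * `|x|) -> continuous f.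
Proof.
move=> fM; apply/linear_bounded_continuous/linear_boundedP; near=> r => x.
by rewrite (le_trans (fM x))// ler_wpM2r//; near: r; exact: nbhs_pinfty_ge.
Unshelve. all: by end_near. Qed.

Lemma operator_norm_le (X Y : normedModType R) (f : {linear X -> Y}) (M : R) :
  (forall x, `|f x| <= M * `|x|) -> 0 <= M -> operator_norm f <= M.
Proof.
move=> fM M0; apply: ge_sup.
  by exists `|f 0|; exists 0 => //; rewrite /unit_ball/= normr0.
by move=> _ [x x1 <-]; rewrite (le_trans (fM x))// ler_piMr.
Qed.

Lemma le_operator_norm (X Y : normedModType R) (f : {linear X -> Y}) x :
  continuous f -> `|x| <= 1 -> `|f x| <= operator_norm f.
Proof.
move=> /linear_bounded_continuous/bounded_funP/(_ 1)[M fM] x1.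
apply: ub_le_sup; last by exists x.
by exists M => _ [z z1 <-]; exact: fM.
Qed.

Section Mean.
Implicit Types (x y z w : l2 R n) (S T : 'M[R]_n) (f g : 'M[R]_n -> R).
Variable mu : probability (borel_mx R n) R.
Hypothesis haar : normalized_haar mu.

(* Hahn-Banach is applied to [n]-tuples [V] of vectors of [Y], seen as operators
   [x |-> \sum_k x_k V_k], with the seminorm [n * mean |V (T y)|] that dominates
   the trace of an operator with values in [i]. *)
Lemma haar_projection (Y : normedModType R) (i : {linear l2 R n -> Y}) y :
  `|y| = 1 -> isometric_embedding i ->
  exists P : {linear Y -> l2 R n},
    (forall x, P (i x) = x) /\
    forall v, `|P v| <= n%:R * mean_width mu y * `|v|.
Proof.
move=> y1 iI.
pose L (V : 'I_n -> Y) (T : 'M[R]_n) := \sum_k l2_entry (mx_act T y) k *: V k.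
have Llin V : linear (L V).
  move=> a S T; rewrite /L scaler_sumr -big_split /=; apply: eq_bigr => k _.
  rewrite scalerA -scalerDl; congr (_ *: _).
  by rewrite /l2_entry /mx_act mulmxDl -scalemxAl !mxE.
have tL V := tame_norm_linear (Llin V).
pose p V := n%:R * mean mu (fun T => `|L V T|).
have psub : sublinear (p : ('I_n -> Y) -> R).
  split=> [V W|a V a0]; rewrite /p.
    rewrite -mulrDr ler_wpM2l// -meanD// le_mean//; first exact: tameD.
    move=> T _; apply: le_trans (ler_normD _ _); rewrite /L -big_split /=.
    by under eq_bigr do rewrite scalerDr.
  rewrite mulrCA ler_wpM2l// -meanZ// le_mean//.
    by apply: tameM => //; exact: tame_cst.
  move=> T _; rewrite -{2}(ger0_norm a0) -normrZ scaler_sumr /L.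
  by under eq_bigr do rewrite scalerA mulrC -scalerA.
pose j (W : 'I_n -> l2 R n) : 'I_n -> Y := fun k => i (W k).
have jlin : linear j by move=> a V W; apply/funext => k; exact: linearP.
pose tr (W : 'I_n -> l2 R n) : R := \sum_k l2_entry (W k) k.
have trlin : linear (tr : _ -> R^o).
  move=> a V W; rewrite /tr scaler_sumr -big_split /=; apply: eq_bigr => k _.
  by rewrite l2_entryD l2_entryZ.
pose jL : {linear ('I_n -> l2 R n) -> ('I_n -> Y)} :=
  HB.pack j (GRing.isLinear.Build R _ _ _ j jlin).
pose trL : {scalar ('I_n -> l2 R n)} :=
  HB.pack tr (GRing.isLinear.Build R _ R^o _ tr trlin).
have trp W : trL W <= p (jL W).
  have tWT k : tame (fun T => l2_dot (W k) (mx_act T y) *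
      l2_dot (l2_basis R k) (mx_act T y)).
    by apply: tameM; exact: tame_dot.
  (* By [mean_dot_dot] each diagonal entry is [n] times a mean, and the trace is [n] times the mean
     of [<W (T y), T y>]. *)
  rewrite /= /tr /p; under eq_bigr do
    rewrite -l2_dot_basisr -(mean_dot_dot haar _ _ y1).
  rewrite -mulr_sumr ler_wpM2l// -mean_sum// le_mean//; first exact: tame_sum.
  move=> T OT; rewrite /L /j/=.
  have -> : \sum_k l2_entry (mx_act T y) k *: i (W k) =
      i (\sum_k l2_entry (mx_act T y) k *: W k).
    by rewrite linear_sum; apply: eq_bigr => k _; rewrite linearZ.
  rewrite iI -[leRHS]mulr1 -y1 -(orthogonal_norm y OT).
  apply: le_trans (le_trans (ler_norm _) (ler_norm_l2_dot _ _)).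
  rewrite l2_dot_suml ler_sum// => k _.
  by rewrite l2_dotZl mulrC (l2_dotC (l2_basis R k)) l2_dot_basisr.
have [F [Fj Fp]] := hahn_banach psub trp.
(* [u v x] is the rank-one operator [z |-> <x, z> v]; the projection is determined by
   [<P v, x> = F (u v x)]. *)
pose u v x : 'I_n -> Y := fun k => l2_entry x k *: v.
have uP v x : F (u v x) = \sum_k l2_entry x k * F (u v (l2_basis R k)).
  rewrite {1}(_ : u v x = \sum_k l2_entry x k *: u v (l2_basis R k)).
    by rewrite linear_sum; apply: eq_bigr => k _; rewrite linearZ.
  apply/funext => k; rewrite fct_sumE (bigD1 k)//= big1 => [|l lk].
    by rewrite addr0 -[RHS]/(_ *: (_ *: v)) l2_entry_basis eqxx scale1r.
  by rewrite -[LHS]/(_ *: (_ *: v)) l2_entry_basis eq_sym (negPf lk) scale0r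
    scaler0.
pose P v : l2 R n := \sum_k F (u v (l2_basis R k)) *: l2_basis R k.
have Plin : linear P.
  move=> a v w; rewrite /P scaler_sumr -big_split /=; apply: eq_bigr => k _.
  rewrite scalerA -scalerDl -linearP; congr (F _ *: _); apply/funext => l.
  by rewrite -[RHS]/(a *: (_ *: v) + _ *: w) /u scalerDr !scalerA mulrC.
have dotP v x : l2_dot (P v) x = F (u v x).
  rewrite uP l2_dot_suml; apply: eq_bigr => k _.
  by rewrite l2_dotZl l2_dotC l2_dot_basisr mulrC.
pose PL : {linear Y -> l2 R n} :=
  HB.pack P (GRing.isLinear.Build R _ _ _ P Plin).
exists PL; split => /= [x|v].
  apply: l2_dot_injr => z; rewrite l2_dotC dotP.
  (* This operator comes from one on R^n whose trace is [<z, x>]. *)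
  rewrite (_ : u (i x) z = jL (fun k => l2_entry z k *: x)).
    by rewrite Fj /= /tr; apply: eq_bigr => k _; rewrite l2_entryZ.
  by apply/funext => k; rewrite /u /= /j linearZ.
have [->|Pv0] := eqVneq (P v) 0.
  by rewrite normr0 mulr_ge0// ltW// mean_width_gt0.
have PvP : 0 < `|P v| by rewrite normr_gt0.
(* Multiplied by [|P v|], the left side is [<P v, P v> = F (u v (P v))]; the seminorm of this
   operator is [n |v|] times the mean of [|<P v, T y>|]. *)
rewrite -(ler_pM2r PvP) -expr2 normr_sq_l2 dotP (le_trans (Fp _))// /p.
have -> : n%:R * mean_width mu y * `|v| * `|P v| =
  n%:R * (`|v| * (mean_width mu y * `|P v|)) by ring.
rewrite ler_wpM2l// -mean_norm_dot//.
rewrite -meanZ//; last exact/tame_norm/tame_dot.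
rewrite le_mean//; first by apply: tameM; [exact:
  tame_cst|exact/tame_norm/tame_dot].
move=> T _; rewrite /L /u mulrC -normrZ /l2_dot scaler_suml.
by under eq_bigr do rewrite scalerA mulrC.
Qed.

End Mean.
End ProjectionConstant.

(** * Polynomials approximating the sign *)

Section SignPolynomial.
Variable R : realType.

(** Started at zero, [p' = p + (t^2 - p^2) / 2] is a classical polynomial iteration for [|t|]; the
    cofactor is [p] divided by [t^2], and ['X] times it approximates the sign. *)
Fixpoint sign_cofactor (k : nat) : {poly R} :=
  if k is k'.+1 then
    sign_cofactor k' + 2^-1 *: (1 - ('X * sign_cofactor k') ^+ 2)
  else 0.

(* With [s = |t|] and [r = s * q_k(t)] the iteration reads
   [r' = r + s (1 - r^2) / 2], so that [1 - r] is multiplied at each step by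
   [1 - s (1 + r) / 2 <= 1 - s / 2]. *)
Lemma sign_cofactor_bounds k (t : R) : `|t| <= 1 ->
  let r := `|t| * (sign_cofactor k).[t] in
  [/\ 0 <= r, r <= 1 & (1 - r) * (2 + k%:R * `|t|) <= 2].
Proof.
move=> t1 /=; elim: k => [|k].
  by rewrite horner0 mulr0 mul0r addr0 subr0 mul1r ler01.
set q := (sign_cofactor k).[t]; set s := `|t|; move=> [r0 r1 rk].
have -> : s * (sign_cofactor k.+1).[t] = s * q + s / 2 * (1 - (s * q) ^+ 2).
  rewrite /= !(hornerE, horner_exp) -/q.
  have -> : (t * q) ^+ 2 = (s * q) ^+ 2 by rewrite !exprMn real_normK ?num_real.
  by ring.
have s0 : 0 <= s by exact: normr_ge0.
move: (s * q) r0 r1 rk => r r0 r1 rk.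
have k0 : 0 <= k%:R :> R by [].
have d0 : 0 <= 1 - r by rewrite subr_ge0.
split.
- by rewrite addr_ge0// mulr_ge0 ?divr_ge0// subr_ge0 expr_le1.
- rewrite -subr_ge0 (_ : _ - _ = (1 - r) * (1 - s * (1 + r) / 2));
  last by field.
  by rewrite mulr_ge0// subr_ge0; have := ler_pM s0 _ t1 (_ : 1 + r <= 2); lra.
(* It remains to see that the new factor outweighs the growth of [2 + k s] by [s]. *)
- apply: le_trans rk; rewrite (_ : 1 - (r + _) = (1 - r) * (1 - s * (1 + r) /
  2)); last by field.
  rewrite -mulrA ler_wpM2l// -natr1.
  rewrite -subr_ge0 (_ : _ - _ = r * s / 2 * (2 + k%:R * s + s) + (k%:R * s ^+
    2 + s ^+ 2) / 2); last by field.
  by rewrite addr_ge0// ?mulr_ge0 ?addr_ge0// mulr_ge0 ?addr_ge0// mulr_ge0.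
Qed.

(** The weight [t] keeps the error uniform down to zero, where the sign jumps. *)
Lemma sign_polynomial (e : R) : 0 < e -> exists p : {poly R}, forall t,
  `|t| <= 1 -> `|p.[t]| <= 1 /\ `|t| - e <= t * p.[t].
Proof.
(* From [(1 - r) (2 + k s) <= 2] follows [s (1 - r) <= 2 / k], which this [k] makes smaller than
   [e]. *)
move=> e0; have [k ke] : exists k : nat, 2 < k%:R * e.
  exists (Num.truncn (2 / e)).+1; rewrite -ltr_pdivrMr//.
  exact: truncnS_gt.
exists ('X * sign_cofactor k) => t t1.
have [r0 r1 rk] := sign_cofactor_bounds k t1.
rewrite hornerM hornerX; split; first by rewrite normrM -{1}(normr_id t)
  -normrM ger0_norm.
rewrite mulrA -expr2 -real_normK ?num_real// expr2 -mulrA.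
have s0 := normr_ge0 t; move: (`|t|) (`|t| * (sign_cofactor k).[t]) s0 r0 r1 rk
  {t1} => s r s0 r0 r1 rk.
have k0 : 0 < k%:R :> R by move: ke; case: k {rk} => [|k];
  rewrite ?ltr0n// mul0r; lra.
rewrite -(ler_pM2l k0); nra.
Qed.

End SignPolynomial.

(** * Linear functionals on bounded functions *)

Section BoundedFunctionsAlgebra.
Variables (R : realType) (T : pointedType).
Implicit Types f g : T -> R.

Lemma bounded_functionsM f g : f \in @bounded_functions R T ->
  g \in @bounded_functions R T -> (fun t => f t * g t) \in @bounded_functions R
    T.
Proof.
move=> /bounded_functionsP[M fM] /bounded_functionsP[N gN].
by apply/bounded_functionsP; exists (M * N) => t; rewrite normrM ler_pM.
Qed.

Lemma bounded_functions_sum I (r : seq I) (F : I -> T -> R) :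
  (forall i, F i \in @bounded_functions R T) ->
  (fun t => \sum_(i <- r) F i t) \in @bounded_functions R T.
Proof.
move=> bF; rewrite (_ : (fun t => _) = \sum_(i <- r) F i);
  first exact: rpred_sum.
by apply/funext => t; rewrite fct_sumE.
Qed.

Lemma bounded_functionsD f g : f \in @bounded_functions R T ->
  g \in @bounded_functions R T ->
  (fun t => f t + g t) \in @bounded_functions R T.
Proof. exact: rpredD. Qed.

Lemma bounded_functionsZ (a : R) f : f \in @bounded_functions R T ->
  (fun t => a * f t) \in @bounded_functions R T.
Proof. exact: rpredZ. Qed.

Variable Phi : {scalar bounded_function R T}.

(* Unbounded functions are sent to the junk value [Phi 0 = 0]. *)
Definition extend0 f : R := Phi (insubd 0 f).

Lemma extend0D f g : f \in @bounded_functions R T ->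
  g \in @bounded_functions R T ->
  extend0 (fun t => f t + g t) = extend0 f + extend0 g.
Proof.
move=> bf bg; rewrite -linearD; congr (Phi _); apply/val_inj => /=.
by rewrite !insubdK//; exact: rpredD.
Qed.

Lemma extend0Z (a : R) f : f \in @bounded_functions R T ->
  extend0 (fun t => a * f t) = a * extend0 f.
Proof.
move=> bf; rewrite -linearZ; congr (Phi _); apply/val_inj => /=.
by rewrite !insubdK//; exact: rpredZ.
Qed.

Lemma extend0_sum I (r : seq I) (F : I -> T -> R) :
  (forall i, F i \in @bounded_functions R T) ->
  extend0 (fun t => \sum_(i <- r) F i t) = \sum_(i <- r) extend0 (F i).
Proof.
move=> bF; elim: r => [|i r IH].
  under eq_fun do rewrite big_nil; rewrite big_nil.
  have := extend0Z 0 (rpred0 (@bounded_functions R T)).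
  by under eq_fun do rewrite mul0r; rewrite mul0r.
under eq_fun do rewrite big_cons.
by rewrite big_cons -IH -extend0D//; exact: bounded_functions_sum.
Qed.

End BoundedFunctionsAlgebra.

(** * The lower bound and the value of the projection constant *)

Section LowerBound.
Variables (R : realType) (n : nat) (mu : probability (borel_mx R n) R).
Hypothesis haar : normalized_haar mu.
Implicit Types (x y z w : l2 R n) (S T U : 'M[R]_n).

(* The integral of a kernel that is polynomial in [l2_dot (c t) (U y)] commutes
   with a functional that need not be continuous for pointwise convergence,
   because such a kernel has finite rank. *)
Lemma mean_extend0 (T : pointedType) (c : T -> l2 R n) (y : l2 R n)
    (Phi : {scalar bounded_function R T}) (p : {poly R}) :
  (forall t, `|c t| <= 1) ->
  let k U t := p.[l2_dot (c t) (mx_act U y)] in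
  forall g, g \in @bounded_functions R T ->
  [/\ forall U, (fun t => g t * k U t) \in @bounded_functions R T,
      tame (fun U => extend0 Phi (fun t => g t * k U t)) &
      forall a, tame a ->
        (fun t => g t * mean mu (fun U => a U * k U t))
          \in @bounded_functions R T /\
        mean mu (fun U => a U * extend0 Phi (fun t => g t * k U t)) =
        extend0 Phi (fun t => g t * mean mu (fun U => a U * k U t))].
Proof.
(* Induction on [p] with [g] and [a] free: in the coordinate expansion of [<c t, U y>], the entries
   of [c t] are absorbed by [g] and those of [U y] by [a]. *)
move=> c1 /=; elim/poly_ind: p => [|p b IH] g bg.
  have b0 : (fun=> 0) \in @bounded_functions R T by exact: rpred0.
  have Phi0 : extend0 Phi (fun=> 0) = 0.
    rewrite -[RHS](mul0r (extend0 Phi (fun=> 0))) -(extend0Z Phi 0 b0).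
    by congr extend0; apply/funext => t; rewrite mul0r.
  have E U : (fun t => g t * (0 : {poly R}).[l2_dot (c t) (mx_act U y)]) =
    fun=> 0.
    by apply/funext => t; rewrite horner0 mulr0.
  have M (a : 'M[R]_n -> R) : (fun t => g t *
      mean mu (fun U => a U * (0 : {poly R}).[l2_dot (c t) (mx_act U y)])) =
        fun=> 0.
    apply/funext => t; under eq_fun do rewrite horner0 mulr0.
    by rewrite (mean_cst haar) mulr0.
  split=> [U||a ta]; rewrite ?M ?E//.
    by under eq_fun do rewrite E Phi0; exact: tame_cst.
  split=> //; under eq_fun do rewrite E Phi0 mulr0.
  by rewrite (mean_cst haar) Phi0.
pose k U t := p.[l2_dot (c t) (mx_act U y)].
pose g_ (j : 'I_n) t := g t * l2_entry (c t) j.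
have bg_ j : g_ j \in @bounded_functions R T.
  apply: bounded_functionsM => //; apply/bounded_functionsP; exists 1 => t.
  rewrite -l2_dot_basisr (le_trans (ler_norm_l2_dot _ _))//.
  by rewrite norm_l2_basis mulr1.
pose u U (j : 'I_n) := l2_entry (mx_act U y) j.
have tu j : tame (fun U => u U j).
  rewrite /u; under eq_fun do rewrite -l2_dot_basisr l2_dotC; exact: tame_dot.
have tk t : tame (fun U => k U t) by apply/tame_horner/tame_dot.
have E U : (fun t => g t * (p * 'X + b%:P).[l2_dot (c t) (mx_act U y)]) =
    (fun t => (\sum_j u U j * (g_ j t * k U t)) + b * g t).
  apply/funext => t; rewrite hornerMXaddC mulrDr (mulrC _ b); congr (_ + _).
  rewrite /l2_dot mulrA mulr_sumr; apply: eq_bigr => j _.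
  by rewrite /g_ /u /k; ring.
have M a : tame a -> (fun t => g t * mean mu
      (fun U => a U * (p * 'X + b%:P).[l2_dot (c t) (mx_act U y)])) =
    (fun t => (\sum_j g_ j t * mean mu (fun U => a U * u U j * k U t)) +
      b * mean mu a * g t).
  move=> ta; apply/funext => t.
  have -> : mean mu
        (fun U => a U * (p * 'X + b%:P).[l2_dot (c t) (mx_act U y)]) =
      \sum_j l2_entry (c t) j * mean mu (fun U => a U * u U j * k U t) +
        b * mean mu a.
    have tj j : tame (fun U => a U * u U j * k U t).
      by apply: tameM => //; exact: tameM.
    transitivity (mean mu (fun U =>
      \sum_j l2_entry (c t) j * (a U * u U j * k U t) + b * a U)).
      apply: eq_mean => U _; rewrite hornerMXaddC mulrDr (mulrC _ b);
        congr (_ + _).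
      rewrite [X in _ * X = _]mulrC mulr_suml mulr_sumr; apply: eq_bigr => j _.
      by rewrite /u /k; ring.
    have tc (d : R) (f : 'M[R]_n -> R) : tame f -> tame (fun U => d * f U).
      by move=> tf; apply: tameM => //; exact: tame_cst.
    rewrite (meanD haar) ?(mean_sum haar) ?(meanZ haar)//; last 3 first.
    - by move=> j; exact: tc.
    - by apply: tame_sum => j; exact: tc.
    - exact: tc.
    by congr (_ + _); apply: eq_bigr => j _; rewrite (meanZ haar).
  rewrite mulrDr mulrC (mulrC (g t)); congr (_ + _); rewrite mulr_suml.
  by apply: eq_bigr => j _; rewrite /g_; ring.
have bE U j : (fun t => g_ j t * k U t) \in @bounded_functions R T.
  by have [+ _ _] := IH _ (bg_ j); exact.
have bS U :
    (fun t => \sum_j u U j * (g_ j t * k U t)) \in @bounded_functions R T.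
  by apply: bounded_functions_sum => j; exact: bounded_functionsZ.
have tP j : tame (fun U => extend0 Phi (fun t => g_ j t * k U t)).
  by have [_ + _] := IH _ (bg_ j).
have PE U : extend0 Phi (fun t => (\sum_j u U j * (g_ j t * k U t)) + b * g t) =
    \sum_j u U j * extend0 Phi (fun t => g_ j t * k U t) + b * extend0 Phi g.
  rewrite extend0D//; last exact: bounded_functionsZ.
  rewrite extend0Z// extend0_sum; last by move=> j; exact: bounded_functionsZ.
  by congr (_ + _); apply: eq_bigr => j _; rewrite extend0Z.
split=> [U||a ta].
- by rewrite E; apply: bounded_functionsD => //; exact: bounded_functionsZ.
- under eq_fun do rewrite E PE.
  by apply: tameD; [apply: tame_sum => j; exact: tameM|exact: tame_cst].
- have tau j : tame (fun U => a U * u U j) by exact: tameM.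
  have bM j : (fun t => g_ j t * mean mu (fun U => a U * u U j * k U t))
      \in @bounded_functions R T.
    by have [_ _ /(_ _ (tau j))[]] := IH _ (bg_ j).
  have eM j :
      mean mu (fun U => a U * u U j * extend0 Phi (fun t => g_ j t * k U t)) =
      extend0 Phi (fun t => g_ j t * mean mu (fun U => a U * u U j * k U t)).
    by have [_ _ /(_ _ (tau j))[]] := IH _ (bg_ j).
  have bSM : (fun t => \sum_j g_ j t * mean mu (fun U => a U * u U j * k U t))
      \in @bounded_functions R T by exact: bounded_functions_sum.
  rewrite M//; split; first by apply: bounded_functionsD => //;
    exact: bounded_functionsZ.
  under eq_fun do rewrite E PE.
  rewrite extend0D//; last exact: bounded_functionsZ.
  rewrite extend0Z// extend0_sum//.
  under [in RHS]eq_bigr do rewrite -eM.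
  transitivity (mean mu (fun U =>
    \sum_j a U * u U j * extend0 Phi (fun t => g_ j t * k U t) +
    (b * extend0 Phi g) * a U)).
    apply: eq_mean => U _; rewrite mulrDr mulrC; congr (_ + _); last by ring.
    by rewrite mulr_suml; apply: eq_bigr => j _; ring.
  rewrite (meanD haar) ?(mean_sum haar) ?(meanZ haar)//; last 3 first.
  - by move=> j; exact: tameM.
  - by apply: tame_sum => j; exact: tameM.
  - by apply: tameM => //; exact: tame_cst.
  by congr (_ + _); ring.
Qed.

(* [y] stands for the missing direction of [0]. *)
Definition direction y w : l2 R n := if w == 0 then y else `|w|^-1 *: w.

Lemma norm_direction y w : `|y| = 1 -> `|direction y w| = 1.
Proof.
rewrite /direction; case: eqVneq => // w0 _.
by rewrite normrZ normfV normr_id mulVf ?normr_eq0.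
Qed.

Lemma dot_direction y w : l2_dot w (direction y w) = `|w|.
Proof.
rewrite /direction; have [->|w0] := eqVneq w 0;
  first by rewrite l2_dot0l normr0.
by rewrite l2_dotZr -normr_sq_l2 expr2 mulKf ?normr_eq0.
Qed.

Lemma mean_width_le_projection_bound y (b : R) : `|y| = 1 ->
  projection_bound (l2 R n) b -> n%:R * mean_width mu y <= b.
Proof.
(* The Banach space consists of the bounded functions on R^n, and [c t] is the direction of [t], so
   that [i x] attains its norm at [t = x]. *)
move=> y1 Pb; pose B : completeNormedModType R := bounded_function R (l2 R n).
pose c := direction y.
have c1 t : `|c t| = 1 by exact: norm_direction.
have c1' t : `|c t| <= 1 by rewrite c1.
have bdot x : (fun t => l2_dot x (c t)) \in @bounded_functions R (l2 R n).
  apply/bounded_functionsP; exists `|x| => t.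
  by rewrite (le_trans (ler_norm_l2_dot _ _))// c1 mulr1.
pose i x : B := BoundedFunction (bdot x).
have ilin : linear i.
  move=> a x z; apply/val_inj/funext => t /=.
  by rewrite l2_dotDl l2_dotZl.
pose iL : {linear l2 R n -> B} :=
  HB.pack i (GRing.isLinear.Build R _ _ _ i ilin).
have iI : isometric_embedding iL.
  move=> x; apply/le_anti/andP; split.
    apply: sup_norm_le => t /=.
    by rewrite (le_trans (ler_norm_l2_dot _ _))// c1 mulr1.
  apply: le_trans (le_sup_norm (i x) x) => /=.
  by rewrite dot_direction normr_id.
have [P [[Pc Pi] Pn]] := Pb B iL iI.
have Pb1 f : `|f| <= 1 -> `|P f| <= b.
  by move=> f1; apply: le_trans Pn; exact: le_operator_norm.
pose phi j f : R := l2_entry (P f) j.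
have philin j : linear (phi j : B -> R^o).
  by move=> a f g; rewrite /phi linearP l2_entryD l2_entryZ.
pose Phi j : {scalar bounded_function R (l2 R n)} :=
  HB.pack (phi j) (GRing.isLinear.Build R B R^o _ (phi j) (philin j)).
apply/ler_addgt0Pr => e e0.
have n0 : 0 < n%:R :> R.
  rewrite lt_def ler0n andbT; apply/eqP => n0.
  by have := mean_width_gt0 haar y1; rewrite n0 mul0r ltxx.
(* After multiplication by [n] the error [e / n] becomes [e]. *)
have [p pP] := sign_polynomial (divr_gt0 e0 n0).
have dot1 U t : orthogonal_group U -> `|l2_dot (c t) (mx_act U y)| <= 1.
  move=> OU; rewrite (le_trans (ler_norm_l2_dot _ _))//.
  by rewrite orthogonal_norm// c1 y1 mulr1.
pose F U t := p.[l2_dot (c t) (mx_act U y)].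
have b1 : (fun=> 1) \in @bounded_functions R (l2 R n).
  by apply/bounded_functionsP; exists 1 => t; rewrite normr1.
have exch j := mean_extend0 y (Phi j) p c1' b1.
have FE U : (fun t => 1 * p.[l2_dot (c t) (mx_act U y)]) = F U.
  by apply/funext => t; rewrite mul1r.
have tu j : tame (fun U => l2_dot (l2_basis R j) (mx_act U y))
  by exact: tame_dot.
pose kap :=
  mean mu (fun U => l2_dot y (mx_act U y) * p.[l2_dot y (mx_act U y)]).
(* Each summand equals [kap]: by [mean_extend0] the mean moves inside the functional, where
   [mean_horner_dot] leaves [kap] times the function [i (l2_basis R j)]. The projection sends this
   function back to the basis vector, whose entry [j] is one. *)
have sumE : \sum_j mean mu (fun U => l2_dot (l2_basis R j) (mx_act U y) *
    extend0 (Phi j) (F U)) = n%:R * kap.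
  rewrite mulr_natl -[X in _ *+ X]card_ord -sumr_const; apply: eq_bigr => j _.
  have [_ _ /(_ _ (tu j))[_]] := exch j; under eq_fun do rewrite FE.
  move=> ->;
  rewrite (_ : (fun t => _) = fun t => kap * l2_dot (l2_basis R j) (c t)).
    rewrite extend0Z// /extend0 (_ : insubd _ _ = i (l2_basis R j)).
      by rewrite /= /phi (Pi (l2_basis R j)) l2_entry_basis eqxx mulr1.
    by apply/val_inj; rewrite insubdK.
  by apply/funext => t; rewrite mul1r mean_horner_dot.
have tP j : tame (fun U => extend0 (Phi j) (F U)).
  by have [_ + _] := exch j; under eq_fun do rewrite FE.
have FB U : F U \in @bounded_functions R (l2 R n).
  have n0' : (0 < n)%N by rewrite -(ltr0n R).
  by have [/(_ U) + _ _] := exch (Ordinal n0'); rewrite FE.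
have nkap : n%:R * kap <= b.
  rewrite -sumE -(mean_sum haar); last by move=> j; exact: tameM.
  rewrite -[leRHS](mean_cst haar) (le_mean haar)//.
  - by apply: tame_sum => j; exact: tameM.
  - exact: tame_cst.
  (* The sum is [<U y, P (F U)>], and [F U] lies in the unit ball since [|p| <= 1] on [-1, 1]. *)
  - move=> U OU;
    rewrite (_ : \sum_j _ =
        l2_dot (mx_act U y) (P (BoundedFunction (FB U)))).
      rewrite (le_trans (ler_norm _))// (le_trans (ler_norm_l2_dot _ _))//.
      rewrite orthogonal_norm// y1 mul1r Pb1//; apply: sup_norm_le => t /=.
      by have [] := pP _ (dot1 U t OU).
    apply: eq_bigr => j _; rewrite l2_dotC l2_dot_basisr;
      congr (_ * l2_entry (P _) j).
    by apply/val_inj; rewrite insubdK.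
have kapge : mean_width mu y - e / n%:R <= kap.
  have ty := tame_dot y y.
  rewrite -[X in _ - X](mean_cst haar) -mulN1r -(meanZ haar);
    last exact: tame_cst.
  rewrite -(meanD haar); [|exact: tame_norm|by apply: tameM; exact: tame_cst].
  apply: (le_mean haar).
  - by apply: tameD; [exact: tame_norm|apply: tameM; exact: tame_cst].
  - by apply: tameM => //; exact: tame_horner.
  - move=> U OU; rewrite mulN1r.
    have [] // := pP (l2_dot y (mx_act U y)).
    by rewrite (le_trans (ler_norm_l2_dot _ _))// orthogonal_norm// y1 mulr1.
rewrite -lerBlDr; apply: le_trans nkap.
have := ler_wpM2l (ltW n0) kapge.
by rewrite mulrBr (mulrC e) mulVKf ?gt_eqF.
Qed.

Lemma projection_bound_mean_width y : `|y| = 1 ->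
  projection_bound (l2 R n) (n%:R * mean_width mu y).
Proof.
move=> y1 Y i iI; have [P [Pi Ple]] := haar_projection haar y1 iI.
exists P; split; last by apply: operator_norm_le => //;
  exact/ltW/mean_width_gt0.
by split=> //; exact: bounded_linear_continuous_le Ple.
Qed.

(** By the two bounds the value is the unique least positive projection bound, so [xget] returns it
    rather than its default. *)
Lemma absolute_projection_constant_l2 y : `|y| = 1 ->
  absolute_projection_constant (l2 R n) = n%:R * mean_width mu y.
Proof.
move=> y1; apply: xget_unique => [|b [b0 Pb bmin]].
  split; first exact: mean_width_gt0.
    exact: projection_bound_mean_width.
  by move=> b _; exact: mean_width_le_projection_bound.
apply/le_anti; rewrite (mean_width_le_projection_bound y1 Pb) andbT.
by rewrite bmin ?mean_width_gt0//; exact: projection_bound_mean_width.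
Qed.

End LowerBound.

(** * Minkowski sums and zonotopes *)

Section MinkowskiSums.
Variables (R : realType) (X : normedModType R).
Implicit Types (A B : set X) (a b : X).

(** Trades weights in a subtype of [0, 1] for plain real ones; [convex_setE] is the converse. *)
Lemma convex_setP A : (forall a b (t : R), A a -> A b -> 0 <= t <= 1 ->
  A (t *: a + (1 - t) *: b)) -> convex_set A.
Proof.
move=> Ac a b t /set_mem Aa /set_mem Ab; apply/mem_set/Ac => //.
by rewrite ge0 le1.
Qed.

Lemma convex_setE A a b (t : R) : convex_set A -> A a -> A b -> 0 <= t <= 1 ->
  A (t *: a + (1 - t) *: b).
Proof.
move=> Ac Aa Ab /andP[t0 t1].
exact: set_mem (Ac a b (Itv01 t0 t1) (mem_set Aa) (mem_set Ab)).
Qed.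

Lemma compact_minkowski_add A B :
  compact A -> compact B -> compact (minkowski_add A B).
Proof.
move=> cA cB;
have -> : minkowski_add A B = (fun ab => ab.1 + ab.2) @` (A `*` B).
  apply/seteqP; split => [_ [a Aa [b Bb <-]]|_ [[a b] [/= Aa Bb] <-]].
    by exists (a, b).
  by exists a => //; exists b.
apply: continuous_compact; last exact: compact_setX.
by apply: continuous_subspaceT; exact: add_continuous.
Qed.

Lemma convex_minkowski_add A B :
  convex_set A -> convex_set B -> convex_set (minkowski_add A B).
Proof.
move=> cA cB; apply: convex_setP => _ _ t [a Aa [b Bb <-]] [c Ac [d Bd <-]] t01.
exists (t *: a + (1 - t) *: c); first exact: convex_setE.
exists (t *: b + (1 - t) *: d); first exact: convex_setE.
by rewrite !scalerDr addrACA.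
Qed.

Lemma compact_segment a b : compact (segment a b).
Proof.
apply: continuous_compact; last exact: segment_compact.
apply: continuous_subspaceT => t; apply: cvgD; apply: cvgZr_tmp => //.
by apply: cvgB; [exact: cvg_cst|].
Qed.

Lemma convex_segment a b : convex_set (segment a b).
Proof.
apply: convex_setP => _ _ t [r r01 <-] [s s01 <-] /andP[t0 t1].
exists (t * r + (1 - t) * s); last first.
  rewrite !scalerDr !scalerA addrACA -!scalerDl; congr (_ *: _ + _).
  by ring.
move: r01 s01; rewrite /= !in_itv/= => /andP[r0 r1] /andP[s0 s1].
rewrite addr_ge0 ?mulr_ge0 ?subr_ge0//=.
have : t * r <= t by rewrite ler_piMr.
have : (1 - t) * s <= 1 - t by rewrite ler_piMr// subr_ge0.
by lra.
Qed.

Lemma scale_set_compact (c : R) A : compact A -> compact (scale_set c A).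
Proof.
move=> cA; apply: continuous_compact => //; apply: continuous_subspaceT.
exact: scaler_continuous.
Qed.

Lemma scale_set_convex (c : R) A : convex_set A -> convex_set (scale_set c A).
Proof.
move=> cA; apply: convex_setP => _ _ t [a Aa <-] [b Ab <-] t01.
exists (t *: a + (1 - t) *: b); first exact: convex_setE.
by rewrite scalerDr !scalerA mulrC (mulrC c).
Qed.

Lemma convex_unit_ball : convex_set (unit_ball X).
Proof.
apply: convex_setP => a b t; rewrite /unit_ball/= => a1 b1 /andP[t0 t1].
rewrite (le_trans (ler_normD _ _))// !normrZ !ger0_norm ?subr_ge0//.
have : t * `|a| <= t by rewrite ler_piMr.
have : (1 - t) * `|b| <= 1 - t by rewrite ler_piMr// subr_ge0.
by lra.
Qed.

Lemma closed_unit_ball : closed (unit_ball X).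
Proof.
rewrite (_ : unit_ball X = Num.norm @^-1` [set r | r <= 1]) //.
apply: closed_comp => [x _|]; first exact: norm_continuous.
exact: closed_le.
Qed.

End MinkowskiSums.

(** The norm is the dominating functional; applied to [- v] it also bounds [F] from below. *)
Lemma hahn_banach_norm (R : realType) (X Y : normedModType R)
    (i : {linear X -> Y}) (f : {scalar X}) : isometric_embedding i ->
  (forall x, `|f x| <= `|x|) ->
  exists F : {scalar Y}, (forall x, F (i x) = f x) /\ forall v, `|F v| <= `|v|.
Proof.
move=> iI f1.
have nsub : sublinear (Num.norm : Y -> R).
  by split=> [v w|a v a0]; rewrite ?ler_normD// normrZ ger0_norm.
have [|F [Fi F1]] := @hahn_banach _ _ _ i f _ nsub.
  by move=> x; rewrite iI (le_trans (ler_norm _)).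
exists F; split=> // v; rewrite ler_norml F1 andbT lerNl -linearN.
by rewrite (le_trans (F1 _))// normrN.
Qed.

(** * Zonotopes and support functions *)

Section Zonotope.
Variables (R : realType) (n : nat).
Implicit Types (x y z : l2 R n) (s : seq 'M[R]_n).

Definition zonotope s y : set (l2 R n) :=
  \big[@minkowski_add R (l2 R n)/[set 0]]_(g <- s)
    segment (- mx_act g y) (mx_act g y).

Lemma zonotope_comb s y (t : 'M[R]_n -> R) :
  (forall g, g \in s -> `|t g| <= 1) ->
  zonotope s y (\sum_(g <- s) t g *: mx_act g y).
Proof.
rewrite /zonotope; elim: s => [|g s IH] t1; rewrite ?big_nil// !big_cons.
exists (t g *: mx_act g y); last first.
  by exists (\sum_(h <- s) t h *: mx_act h y) => //; apply: IH => h hs;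
    rewrite t1// inE hs orbT.
have : `|t g| <= 1 by rewrite t1// inE eqxx.
(* The point of the segment with parameter [s] is [(2 s - 1) g y]. *)
rewrite ler_norml => /andP[tg0 tg1]; exists ((1 + t g) / 2).
  by rewrite /= in_itv/=; apply/andP; split; lra.
by rewrite scalerN -scaleNr -scalerDl; congr (_ *: _); field.
Qed.

Lemma zonotope_width s y x k : zonotope s y k ->
  `|l2_dot k x| <= \sum_(g <- s) `|l2_dot (mx_act g y) x|.
Proof.
rewrite /zonotope; elim: s k => [|g s IH] k; rewrite ?big_nil ?big_cons.
  by move=> ->; rewrite l2_dot0l normr0.
move=> [_ [t t01 <-] [b /IH bx <-]].
move: t01; rewrite /= in_itv/= => /andP[t0 t1].
rewrite l2_dotDl (le_trans (ler_normD _ _))// lerD//.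
rewrite scalerN -scaleNr -scalerDl l2_dotZl normrM ler_piMl//.
by rewrite ler_norml; apply/andP; split; lra.
Qed.

Lemma zonotope_compact s y : compact (zonotope s y).
Proof.
rewrite /zonotope; elim/big_ind: _ => [|A B|g _]; first exact: compact_set1.
  exact: compact_minkowski_add.
exact: compact_segment.
Qed.

Lemma zonotope_convex s y : convex_set (zonotope s y).
Proof.
rewrite /zonotope; elim/big_ind: _ => [|A B|g _].
- by apply: convex_setP => _ _ t -> -> _; rewrite !scaler0 addr0.
- exact: convex_minkowski_add.
- exact: convex_segment.
Qed.

Lemma zonotope_sym s y k : zonotope s y k -> zonotope s y (- k).
Proof.
rewrite /zonotope; elim: s k => [|g s IH] k; rewrite ?big_nil ?big_cons.
  by move=> ->; rewrite oppr0.
move=> [_ [t t01 <-] [b /IH bs <-]].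
move: t01; rewrite /= in_itv/= => /andP[t0 t1].
rewrite opprD; exists (- ((1 - t) *: - mx_act g y + t *: mx_act g y));
  last by exists (- b).
exists (1 - t); first by rewrite /= in_itv/=; apply/andP; split; lra.
by rewrite subKr opprD !scalerN opprK addrC.
Qed.

(** The supremum is attained at the combination whose coefficients are the signs of [<x, T g y>]. *)
Lemma support_function_zonotope s y (a : R) (T : 'M[R]_n) x : 0 <= a ->
  support_function (mx_act T @` scale_set a (zonotope s y)) x =
  a * \sum_(g <- s) `|l2_dot x (mx_act T (mx_act g y))|.
Proof.
move=> a0; have dotT g : l2_dot (mx_act g y) (mx_act T^T x) =
    l2_dot x (mx_act T (mx_act g y)) by rewrite -l2_dot_mx_act l2_dotC.
rewrite /support_function; set S := [set l2_dot k x | k in _].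
have Sub : ubound S (a * \sum_(g <- s) `|l2_dot x (mx_act T (mx_act g y))|).
  move=> _ [_ [_ [k Zk <-] <-] <-].
  rewrite mx_actZ l2_dotZl l2_dot_mx_act ler_wpM2l//.
  rewrite (le_trans (ler_norm _))// (le_trans (zonotope_width _ Zk))//.
  by under eq_bigr do rewrite dotT.
have Sm : S (a * \sum_(g <- s) `|l2_dot x (mx_act T (mx_act g y))|).
  pose t g := Num.sg (l2_dot x (mx_act T (mx_act g y))).
  exists (mx_act T (a *: \sum_(g <- s) t g *: mx_act g y)).
    exists (a *: \sum_(g <- s) t g *: mx_act g y) => //.
    exists (\sum_(g <- s) t g *: mx_act g y) => //.
    by apply: zonotope_comb => g _; rewrite normr_sg; case: (_ != 0);
      rewrite ?ler01.
  rewrite mx_actZ l2_dotZl l2_dot_mx_act l2_dot_suml; congr (_ * _).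
  by apply: eq_bigr => g _; rewrite l2_dotZl dotT normrEsg.
by apply/le_anti; rewrite ge_sup ?ub_le_sup//;
  [exists (a * \sum_(g <- s) `|l2_dot x (mx_act T (mx_act g y))|)|
  exists (a * \sum_(g <- s) `|l2_dot x (mx_act T (mx_act g y))|)].
Qed.

Lemma support_function_ball (a : R) x : 0 <= a ->
  support_function (scale_set a (unit_ball (l2 R n))) x = a * `|x|.
Proof.
move=> a0; rewrite /support_function; set S := [set l2_dot k x | k in _].
have Sub : ubound S (a * `|x|).
  move=> _ [_ [k k1 <-] <-]; rewrite l2_dotZl ler_wpM2l//.
  by rewrite (le_trans (ler_norm _))// (le_trans (ler_norm_l2_dot _ _))//
    ler_piMl.
have Sm : S (a * `|x|).
  (* For [x = 0] the inverse of zero is zero, and the witness is [0]. *)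
  exists (a *: (`|x|^-1 *: x)).
    exists (`|x|^-1 *: x) => //; rewrite /unit_ball/= normrZ normfV normr_id.
    have [->|x0] := eqVneq `|x| 0; first by rewrite mulr0.
    by rewrite mulVf.
  rewrite !l2_dotZl -normr_sq_l2 expr2; congr (_ * _).
  have [->|x0] := eqVneq `|x| 0; first by rewrite !mulr0.
  by rewrite mulKf.
by apply/le_anti; rewrite ge_sup ?ub_le_sup//; exists (a * `|x|).
Qed.

End Zonotope.

(** * The zonotope of the orbit of [y] as a small sufficient enlargement *)

Section IrreducibleGroup.
Variables (R : realType) (n : nat) (G : {fset 'M[R]_n}).
Hypothesis G_subgroup : finite_orthogonal_subgroup G.
Hypothesis G_commutant : forall T : 'M[R]_n,
  (forall g, g \in G -> T *m g = g *m T) -> exists c : R, T = c%:M.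
Variable y : l2 R n.
Hypothesis y1 : `|y| = 1.

Let N : R := #|` G|%:R.

Let G_orth g : g \in G -> orthogonal_group g.
Proof. by case: G_subgroup => + _ _ _; exact. Qed.

Let N_gt0 : 0 < N.
Proof.
rewrite ltr0n cardfs_gt0; apply/fset0Pn; exists 1%:M.
by case: G_subgroup.
Qed.

(** Allows sums over [G] to be reindexed by left translation. *)
Lemma perm_mulmx_subgroup h : h \in G -> perm_eq (map (mulmx h) G) G.
Proof.
move=> hG; case: G_subgroup => _ _ GM GV.
have hU : h \in unitmx by have /mulmx1_unit[] := G_orth hG.
apply: uniq_perm; [|exact: fset_uniq|move=> g].
  rewrite map_inj_uniq ?fset_uniq// => g k gk.
  by rewrite -[g](mulKmx hU) gk mulKmx.
apply/mapP/idP => [[k kG ->]|gG]; first exact: GM.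
by exists (invmx h *m g); [exact/GM/gG/GV|rewrite mulKVmx].
Qed.

(* The frame operator of the orbit of [y] commutes with [G], hence is a scalar,
   which its trace determines. *)
Lemma orbit_frame x :
  n%:R *: \sum_(g <- G) l2_dot (mx_act g y) x *: mx_act g y = N *: x.
Proof.
pose v g : 'cV[R]_n := mx_act g y.
pose M := \sum_(g <- G) v g *m (v g)^T.
have ME z : mx_act M z = \sum_(g <- G) l2_dot (mx_act g y) z *: mx_act g y.
  rewrite /mx_act /M mulmx_suml; apply: eq_bigr => g _.
  by rewrite -mulmxA [_^T *m _]mx11_scalar -l2_dot_mxE mul_mx_scalar.
have MC h : h \in G -> M *m h = h *m M.
  move=> hG; have hh : h^T *m h = 1%:M.
    by have := orthogonal_trmx (G_orth hG); rewrite /orthogonal_group/= trmxK.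
  (* Reindexing by [g |-> h g] gives [M = h M h^T]; then multiply by [h] on the right. *)
  rewrite {1}/M -(perm_big _ (perm_mulmx_subgroup hG)) big_map.
  rewrite mulmx_suml mulmx_sumr; apply: eq_bigr => g _.
  by rewrite /v mx_actM /mx_act trmx_mul -!mulmxA hh mulmx1.
have [c Mc] := G_commutant MC.
have cE z : \sum_(g <- G) l2_dot (mx_act g y) z *: mx_act g y = c *: z.
  by rewrite -ME Mc /mx_act mul_scalar_mx.
(* The trace of the frame operator, computed twice: the sum of [|g y|^2] is [N], and the trace of
   the scalar [c] is [n c]. *)
have -> : N = n%:R * c; last by rewrite cE scalerA.
transitivity (\sum_(g <- G) l2_dot (mx_act g y) (mx_act g y)).
  rewrite big_seq (eq_bigr (fun=> 1)) => [|g gG]; last first.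
    by rewrite -normr_sq_l2 orthogonal_norm ?y1 ?expr1n//; exact: G_orth.
  by rewrite -big_seq big_const_seq count_predT iter_addr_0.
transitivity (\sum_j \sum_(g <- G) l2_dot (mx_act g y) (l2_basis R j) ^+ 2).
  rewrite exchange_big; apply: eq_bigr => g _; apply: eq_bigr => j _.
  by rewrite l2_dot_basisr expr2.
transitivity (\sum_(j < n) c); last by rewrite sumr_const card_ord mulr_natl.
apply: eq_bigr => j _; transitivity (l2_dot (c *: l2_basis R j) (l2_basis R j)).
  rewrite -cE l2_dot_suml; apply: eq_bigr => g _.
  by rewrite l2_dotZl expr2.
by rewrite l2_dotZl l2_dot_basisr l2_entry_basis eqxx mulr1.
Qed.

Definition orbit_enlargement : set (l2 R n) :=
  scale_set (n%:R / N) (zonotope G y).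

Lemma orbit_enlargement_comb (t : 'M[R]_n -> R) :
  (forall g, g \in G -> `|t g| <= 1) ->
  orbit_enlargement ((n%:R / N) *: \sum_(g <- G) t g *: mx_act g y).
Proof.
move=> t1; exists (\sum_(g <- G) t g *: mx_act g y) => //.
exact: zonotope_comb.
Qed.

Lemma orbit_reconstruct x :
  (n%:R / N) *: \sum_(g <- G) l2_dot (mx_act g y) x *: mx_act g y = x.
Proof.
by rewrite mulrC -scalerA orbit_frame scalerA mulVf ?scale1r// gt_eqF.
Qed.

Lemma ler_norm_orbit_dot g x : g \in G -> `|l2_dot (mx_act g y) x| <= `|x|.
Proof.
move=> gG; rewrite (le_trans (ler_norm_l2_dot _ _))//
  orthogonal_norm ?y1 ?mul1r//.
exact: G_orth.
Qed.

(** In the reconstruction of [x] from the orbit the coefficients are at most one in absolute value.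
    The inclusion provides interior points, and later the compactness of the unit ball. *)
Lemma unit_ball_sub_orbit_enlargement :
  unit_ball (l2 R n) `<=` orbit_enlargement.
Proof.
move=> x x1; rewrite -(orbit_reconstruct x);
apply: orbit_enlargement_comb => g gG.
exact: le_trans (ler_norm_orbit_dot _ gG) x1.
Qed.

Lemma orbit_enlargement_compact : compact orbit_enlargement.
Proof. exact/scale_set_compact/zonotope_compact. Qed.

Lemma orbit_enlargement_ball : convex_body_ball orbit_enlargement.
Proof.
split.
- exact/compact_bounded/orbit_enlargement_compact.
- by apply: compact_closed; [exact: norm_hausdorff|
  exact: orbit_enlargement_compact].
- exact/scale_set_convex/zonotope_convex.
- exists 0; apply/nbhs_norm0P; exists 1 => //= x /= x1.
  by apply: unit_ball_sub_orbit_enlargement; exact: ltW.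
- by move=> _ [k Zk <-]; exists (- k); [exact: zonotope_sym|rewrite scalerN].
Qed.

Lemma orbit_enlargement_sufficient : sufficient_enlargement orbit_enlargement.
Proof.
split=> [|Y i iI]; first exact: orbit_enlargement_ball.
have ext z : `|z| = 1 -> exists F : {scalar Y},
    (forall x, F (i x) = l2_dot z x) /\ forall v, `|F v| <= `|v|.
  move=> z1; have flin : linear (l2_dot z : l2 R n -> R^o).
    by move=> a x w; rewrite l2_dotDr l2_dotZr.
  pose f : {scalar l2 R n} :=
    HB.pack (l2_dot z) (GRing.isLinear.Build R (l2 R n) R^o _ (l2_dot z) flin).
  apply: (hahn_banach_norm (f := f) iI) => x.
  by rewrite (le_trans (ler_norm_l2_dot _ _))// z1 mul1r.
(* Outside [G] the functional is arbitrary, and the one for [y] is taken. *)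
have /choice[F FG] : forall g : 'M[R]_n, exists F : {scalar Y}, g \in G ->
    (forall x, F (i x) = l2_dot (mx_act g y) x) /\ forall v, `|F v| <= `|v|.
  move=> g; have [gG|gG] := boolP (g \in G); last by have [F _] := ext y y1;
    exists F.
  by have [|F FP] := ext (mx_act g y); [rewrite orthogonal_norm//;
    exact: G_orth|exists F].
pose P v : l2 R n := (n%:R / N) *: \sum_(g <- G) F g v *: mx_act g y.
have Plin : linear P.
  move=> a v w; rewrite /P scalerA (mulrC a) -(scalerA (n%:R / N)) -scalerDr;
    congr (_ *: _).
  rewrite scaler_sumr -big_split /=; apply: eq_bigr => g _.
  by rewrite linearP scalerDl scalerA.
pose PL : {linear Y -> l2 R n} :=
  HB.pack P (GRing.isLinear.Build R _ _ _ P Plin).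
exists PL; split; first split.
- apply: (@bounded_linear_continuous_le _ _ _ _ (n%:R / N * N)) => v.
  rewrite /= normrZ ger0_norm ?divr_ge0 ?ler0n//
    -[leRHS]mulrA ler_wpM2l ?divr_ge0 ?ler0n//.
  rewrite (le_trans (ler_norm_sum _ _ _))//.
  have -> : N * `|v| = \sum_(g <- G) `|v|.
    by rewrite big_const_seq count_predT iter_addr_0 mulr_natl.
  rewrite big_seq [leRHS]big_seq ler_sum// => g gG.
  by rewrite normrZ orthogonal_norm ?y1 ?mulr1;
    [exact: (FG g gG).2|exact: G_orth].
- move=> x; rewrite -[RHS]orbit_reconstruct /= /P; congr (_ *: _).
  by apply: eq_big_seq => g gG; rewrite (FG g gG).1.
- move=> _ [v v1 <-]; apply: orbit_enlargement_comb => g gG.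
  exact: le_trans ((FG g gG).2 v) v1.
Qed.

Lemma orbit_enlargement_integral (mu : probability (borel_mx R n) R) :
  normalized_haar mu ->
  is_minkowski_integral mu (fun T => mx_act T @` orbit_enlargement)
    (scale_set (absolute_projection_constant (l2 R n)) (unit_ball (l2 R n))).
Proof.
move=> haar; have lamE z : `|z| = 1 -> absolute_projection_constant (l2 R n) =
    n%:R * mean_width mu z by exact: absolute_projection_constant_l2.
set lam := absolute_projection_constant _ in lamE *.
have lam0 : 0 <= lam by rewrite (lamE y)// ltW// mean_width_gt0.
have a0 : 0 <= n%:R / N by rewrite divr_ge0// ler0n.
split.
- by exists (lam *: 0); exists 0 => //; rewrite /unit_ball/= normr0.
(* The unit ball is a closed subset of the compact orbit enlargement. *)
- apply: scale_set_compact;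
  apply: subclosed_compact orbit_enlargement_compact _.
    exact: closed_unit_ball.
  exact: unit_ball_sub_orbit_enlargement.
- exact/scale_set_convex/convex_unit_ball.
- move=> x; rewrite support_function_ball//.
  pose h T := n%:R / N * \sum_(g <- G) `|l2_dot x (mx_act T (mx_act g y))|.
  have tg g : tame (fun T => `|l2_dot x (mx_act T (mx_act g y))|).
    by apply: tame_norm; exact: tame_dot.
  have th : tame h by apply: tameM; [exact: tame_cst|exact: tame_sum].
  (* Every [g y] is a unit vector, so [n] times the mean of its term is [lam |x|] for each [g], and
     so is the average over [G]. *)
  have -> : lam * `|x| = mean mu h.
    rewrite /h (meanZ haar); last exact: tame_sum.
    rewrite (mean_sum haar)// mulrAC mulr_sumr.
    rewrite (eq_big_seq (fun=> lam * `|x|)) => [|g gG]; last first.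
      have gy : `|mx_act g y| = 1 by rewrite orthogonal_norm//; exact: G_orth.
      by rewrite (mean_norm_dot haar)// mulrA -lamE.
    by rewrite big_const_seq count_predT iter_addr_0 -[_ *+ _]mulr_natr -/N
      mulfK// gt_eqF.
  rewrite /mean /Rintegral fineK; last first.
    have mO := @orthogonal_group_measurable R n.
    exact: integrable_fin_num (tame_integrable haar th).
  by apply: eq_integral => T _; rewrite support_function_zonotope.
Qed.

End IrreducibleGroup.

Unset Implicit Arguments.

Theorem theorem4 (R : realType) (n : nat) (G : {fset 'M[R]_n})
  (G_subgroup : finite_orthogonal_subgroup G)
  (G_commutant : forall T : 'M[R]_n,
    (forall g, g \in G -> T *m g = g *m T) -> exists c : R, T = c%:M)
  (y : l2 R n) (y_sphere : `|y| = 1) :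
  small_sufficient_enlargement
    (scale_set (n%:R / #|` G|%:R)
      (\big[@minkowski_add R (l2 R n)/[set 0]]_(g <- G)
        segment (- mx_act g y) (mx_act g y))).
Proof.
split; first exact: (orbit_enlargement_sufficient G_subgroup).
move=> mu haar; exact: (orbit_enlargement_integral G_subgroup).
Qed.
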